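(* Let $n\ge 1$ and let $i,m\in\mathbb{Z}$ with $1\le m<n/3-1$. Let $$S=[i-(m-1),\,i+(m-1)]_2,\qquad S'=\left[i-\tfrac12(m-1),\,i+\tfrac12(m-1)\right]_1 .$$ Then the iterate $T^k$ of the pentagram map is singular on $X_S\subseteq\mathcal{P}_n$ for $1\le k\le m+1$, but $T^{m+2}$ is nonsingular at generic $A\in X_S$. Moreover, $T^{m+2}(A)\in Y_{S'}$ for such $A$.
   Context: Notation: $[a,b]_k=\{a,a+k,a+2k,\dots,b\}$ (for $a\le b$ with $b-a$ a multiple of $k$; also used for half-integers $a,b$). $\overleftrightarrow{PQ}$ is the line through $P,Q$. Twisted polygons: work in the real projective plane. A twisted $n$-gon is a sequence $A=(A_i)$ of points, indexed either by $\mathbb{Z}$ or by $\frac12+\mathbb{Z}$, such that $A_{i+n}=\phi(A_i)$ for all $i$ for some projective transformation $\phi$, and such that every four consecutive points are in general position. $A$ and $B$ are projectively equivalent if $\psi(A_i)=B_i$ for all $i$ for some projective transformation $\psi$. $\mathcal{P}_n$ (resp. $\mathcal{P}_n^*$) is the space of twisted $n$-gons indexed by $\mathbb{Z}$ (resp. by $\frac12+\mathbb{Z}$) modulo projective equivalence. Coordinates: $[a,b,c,d]=\frac{(a-b)(c-d)}{(b-c)(d-a)}$ is the cross ratio (of collinear points) and $\chi(a,b,c,d)=[b,a,c,d]$. For each index $k$ of $A$, $x_{2k}(A)=\chi(A_{k-2},A_{k-1},B,D)$ and $x_{2k+1}(A)=\chi(A_{k+2},A_{k+1},C,D)$, where $B=\overleftrightarrow{A_{k-2}A_{k-1}}\cap\overleftrightarrow{A_kA_{k+1}}$,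 $C=\overleftrightarrow{A_{k-1}A_k}\cap\overleftrightarrow{A_{k+1}A_{k+2}}$, $D=\overleftrightarrow{A_{k-2}A_{k-1}}\cap\overleftrightarrow{A_{k+1}A_{k+2}}$. Then $x_{j+2n}=x_j$, and $x_1,\dots,x_{2n}$ are (generically defined) coordinates on $\mathcal{P}_n$ and on $\mathcal{P}_n^*$. The $y$-parameters are: on $\mathcal{P}_n$, $y_j=-(x_jx_{j+1})^{-1}$ for $j$ even and $y_j=-x_jx_{j+1}$ for $j$ odd; on $\mathcal{P}_n^*$, $y_j=-x_jx_{j+1}$ for $j$ even and $y_j=-(x_jx_{j+1})^{-1}$ for $j$ odd. Pentagram map: $T$ sends $A$ to $B$ with $B_i=\overleftrightarrow{A_{i-3/2}A_{i+1/2}}\cap\overleftrightarrow{A_{i-1/2}A_{i+3/2}}$, giving rational maps $\alpha_2:\mathcal{P}_n\to\mathcal{P}_n^*$ and $\alpha_1:\mathcal{P}_n^*\to\mathcal{P}_n$. In coordinates, on $\mathcal{P}_n$: $x_j(T(A))=x_{j+1}\frac{1-x_{j+3}x_{j+2}}{1-x_{j-1}x_{j-2}}$ for $j$ even and $x_j(T(A))=x_{j-1}\frac{1-x_{j-3}x_{j-2}}{1-x_{j+1}x_{j+2}}$ for $j$ odd; on $\mathcal{P}_n^*$ the same with the words even and odd interchanged. $T^k$ denotes the $k$-fold iterate, as a rational map with target $\mathcal{P}_n$ or $\mathcal{P}_n^*$ depending on the parity of $k$. A point is a singular point of the rational map $T^k$ if $T^k$ is not defined (regular) there; $T^k$ is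 singular on a subvariety if its points are singular points of $T^k$. ''Generic $A\in X$'' means $A$ in some dense (Zariski) open subset of $X$. Subvarieties: for $i\in\mathbb{Z}$, $X_i=\{A\in\mathcal{P}_n: y_{2i}(A)=-1\}$ and $Y_i=\{A\in\mathcal{P}_n^*: y_{2i}(A)=-1\}$; for $j\in\frac12+\mathbb{Z}$, $Y_j=\{A\in\mathcal{P}_n: y_{2j}(A)=-1\}$ and $X_j=\{A\in\mathcal{P}_n^*: y_{2j}(A)=-1\}$. For $S\subseteq\mathbb{Z}$ or $S\subseteq\frac12+\mathbb{Z}$, $X_S=\bigcap_{i\in S}X_i$ and $Y_S=\bigcap_{i\in S}Y_i$. *)

(* Defs.v *)
From HB Require Import structures.
From mathcomp Require Import all_boot all_order all_algebra.
From mathcomp Require Import ring zify mpoly.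
From mathcomp Require Import boolp classical_sets reals.

Set Implicit Arguments.
Unset Strict Implicit.
Unset Printing Implicit Defensive.

Import Order.TTheory GRing.Theory Num.Theory.
Local Open Scope ring_scope.
Local Open Scope classical_set_scope.

(* Points of the real projective plane are given by homogeneous coordinates in
   R^3 \ {0}, and lines by the coordinates of a nonzero covector.

   An index in (1/2)Z is encoded by its double, an integer: the vertex A_k is
   [A (2k)]. The boolean [e] is the parity of the doubled indices: [e = false]
   for sequences indexed by Z, [e = true] for those indexed by 1/2 + Z. The
   values of [A] at integers of the other parity are irrelevant.

   A point of P_n (for [e = false]) or P_n^* (for [e = true]) is represented by
   a twisted n-gon. Every notion below depends only on its class modulo
   projective equivalence, see [xcoord_proj_equiv]. *)

Section Plane.
Variable R : realType.
Implicit Types u v w a b c d : 'rV[R]_3.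

(* Indices are in Z/3Z. *)
Definition cross u v : 'rV[R]_3 :=
  \row_(j < 3) (u 0 (j + 1) * v 0 (j + 2%:R) - u 0 (j + 2%:R) * v 0 (j + 1)).

Definition dot u v : R := (u *m v^T) 0 0.

Definition same_point u v : Prop := exists2 t : R, t != 0 & v = t *: u.

Definition line_through u v : 'rV[R]_3 := cross u v.
Definition meet_lines u v : 'rV[R]_3 := cross u v.

Definition collinear u v w : Prop := dot (line_through u v) w = 0.

Definition general_position a b c d : Prop :=
  [/\ ~ collinear a b c, ~ collinear a b d, ~ collinear a c d &
      ~ collinear b c d].

(* The cross ratio (a-b)(c-d) / ((b-c)(d-a)) of four points on a line: if N is
   a covector of this line, then a x b, b x c, c x d and d x a are multiples of
   N with coefficients proportional to a-b, b-c, c-d and d-a in an affine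
   coordinate of the line, and N.N <> 0 cancels out. The quotient is
   homogeneous of degree 0 in each of a, b, c, d. *)
Definition cross_ratio a b c d : R :=
  dot (cross a b) (cross c d) / dot (cross b c) (cross d a).

Definition chi a b c d : R := cross_ratio b a c d.

End Plane.

Section TwistedPolygons.
Variable R : realType.

Definition polygon := int -> 'rV[R]_3.
Implicit Types (A B C : polygon) (e : bool) (n k : nat) (I : int).

Definition has_parity e I : bool := odd `|I|%N == e.

Definition twisted e n : set polygon := [set A |
  (forall I, has_parity e I ->
     general_position (A I) (A (I + 2)) (A (I + 4)) (A (I + 6))) /\
  exists2 phi : 'M[R]_3, phi \in unitmx &
    forall I, has_parity e I -> same_point (A I *m phi) (A (I + (2 * n)%:Z))].

Definition proj_equiv e A B : Prop :=
  exists2 psi : 'M[R]_3, psi \in unitmx &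
    forall I, has_parity e I -> same_point (A I *m psi) (B I).

(* x_j: the index k of the vertices is J / 2, where J is the one of j and
   j - 1 which has parity [e]. *)
Definition xcoord e A (j : int) : R :=
  let J := if has_parity e j then j else j - 1 in
  let D := meet_lines (line_through (A (J - 4)) (A (J - 2)))
                      (line_through (A (J + 2)) (A (J + 4))) in
  if has_parity e j then
    let B := meet_lines (line_through (A (J - 4)) (A (J - 2)))
                        (line_through (A J) (A (J + 2))) in
    chi (A (J - 4)) (A (J - 2)) B D
  else
    let C := meet_lines (line_through (A (J - 2)) (A J))
                        (line_through (A (J + 2)) (A (J + 4))) in
    chi (A (J + 4)) (A (J + 2)) C D.

Definition yparam e A (j : int) : R :=
  if has_parity e j then - (xcoord e A j * xcoord e A (j + 1))^-1
  else - (xcoord e A j * xcoord e A (j + 1)).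

Definition xvec e n A : 'I_(2 * n) -> R := fun j => xcoord e A j.+1%:Z.
Arguments xvec : clear implicits.

(* The pentagram map, sending the indices of one parity to the other one. It is
   total on sequences of vectors; where a line or an intersection point is not
   defined, it yields the vector 0, which is not a point. *)
Definition pentagram A : polygon := fun I =>
  meet_lines (line_through (A (I - 3)) (A (I + 1)))
             (line_through (A (I - 1)) (A (I + 3))).

Definition pentagram_defined e n k A : Prop :=
  forall l, (l <= k)%N -> twisted (odd l (+) e) n (iter l pentagram A).

(* x_1, ..., x_2n embed P_n (resp. P_n^* ) as the open subset of the affine
   space R^(2n) on which no coordinate vanishes; the Zariski topology and the
   rational functions are those of this variety. *)
Definition zariski_open e n (U : set polygon) : Prop :=
  exists F : set {mpoly R[2 * n]},
    U = [set A | twisted e n A /\ exists2 f, F f & f.@[xvec e n A] != 0].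

Definition generically e n (X Q : set polygon) : Prop :=
  exists U : set polygon,
    [/\ zariski_open e n U,
        (forall V, zariski_open e n V -> (exists A, X A /\ V A) ->
           exists A, [/\ X A, V A & U A]) &
        forall A, X A -> U A -> Q A].

Definition ratfun_at n (p q : {mpoly R[2 * n]}) (z : 'I_(2 * n) -> R) (r : R) :
  Prop := q.@[z] != 0 /\ r = p.@[z] / q.@[z].

(* The coordinates of the rational map T^k are the fractions p j / q j. *)
Definition iterate_fractions e n k (p q : 'I_(2 * n) -> {mpoly R[2 * n]}) :
  Prop :=
  generically e n (twisted e n) [set C | pentagram_defined e n k C /\
    forall j, ratfun_at (p j) (q j) (xvec e n C)
                (xvec (odd k (+) e) n (iter k pentagram C) j)].

(* The rational map T^k is regular at A, with value the class of B. *)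
Definition iterate_value e n k A B : Prop :=
  [/\ twisted e n A, twisted (odd k (+) e) n B &
    exists p q, iterate_fractions e k p q /\
      forall j, ratfun_at (p j) (q j) (xvec e n A)
                  (xvec (odd k (+) e) n B j)].

Definition regular_at e n k A : Prop := exists B, iterate_value e n k A B.
Definition singular_at e n k A : Prop := twisted e n A /\ ~ regular_at e n k A.

(* [a, b]_d, for d > 0 and b - a a multiple of d *)
Definition progression (a b d : int) : set int :=
  [set s | s <= b /\ exists t : nat, s = a + d * t%:Z].

(* For a set [S] of (doubled) indices of parity [e], X_S consists of polygons
   whose vertices have indices of this parity, and Y_S of the other ones. *)
Definition Xvar e n (S : set int) : set polygon :=
  [set A | twisted e n A /\ forall s, S s -> yparam e A s = -1].
Definition Yvar e n (S : set int) : set polygon :=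
  [set A | twisted (~~ e) n A /\ forall s, S s -> yparam (~~ e) A s = -1].

End TwistedPolygons.

Section Invariance.
Variable R : realType.
Implicit Types u v w a b c d f l m p q : 'rV[R]_3.
Implicit Types (s t r : R) (M : 'M[R]_3).

Definition triple u v w : R := dot (cross u v) w.

Lemma sum3E (F : 'I_3 -> R) : \sum_i F i = F 0 + F 1 + F 2%:R.
Proof.
rewrite !big_ord_recl big_ord0 addr0 addrA.
by congr (_ + F _ + F _); apply: val_inj.
Qed.

Lemma dotE u v : dot u v = u 0 0 * v 0 0 + u 0 1 * v 0 1 + u 0 2%:R * v 0 2%:R.
Proof. by rewrite /dot mxE sum3E !mxE. Qed.

Lemma crossE u v : (cross u v 0 0 = u 0 1 * v 0 2%:R - u 0 2%:R * v 0 1) *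
  (cross u v 0 1 = u 0 2%:R * v 0 0 - u 0 0 * v 0 2%:R) *
  (cross u v 0 2%:R = u 0 0 * v 0 1 - u 0 1 * v 0 0).
Proof.
have E : [/\ (0 + 1 = 1 :> 'I_3), (0 + 2%:R = 2%:R :> 'I_3),
  (1 + 1 = 2%:R :> 'I_3), (1 + 2%:R = 0 :> 'I_3) &
  (2%:R + 1 = 0 :> 'I_3) /\ (2%:R + 2%:R = 1 :> 'I_3)].
  by split; try split; apply: val_inj.
by case: E => E1 E2 E3 E4 [E5 E6]; rewrite !mxE E1 E2 E3 E4 E5 E6.
Qed.

Lemma row3P u v : u 0 0 = v 0 0 -> u 0 1 = v 0 1 -> u 0 2%:R = v 0 2%:R -> u = v.
Proof.
move=> h0 h1 h2; apply/rowP => -[[|[|[|//]]] hi].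
- by rewrite (_ : Ordinal hi = 0) //; apply: val_inj.
- by rewrite (_ : Ordinal hi = 1) //; apply: val_inj.
- by rewrite (_ : Ordinal hi = 2%:R) //; apply: val_inj.
Qed.

Lemma rowDE u v i : (u + v) 0 i = u 0 i + v 0 i. Proof. exact: mxE. Qed.
Lemma rowNE u i : (- u) 0 i = - u 0 i. Proof. exact: mxE. Qed.
Lemma rowZE s u i : (s *: u) 0 i = s * u 0 i. Proof. exact: mxE. Qed.
Definition rowE := (rowDE, rowNE, rowZE, crossE).

Lemma crossC u v : cross u v = - cross v u.
Proof. by apply: row3P; rewrite !rowE; ring. Qed.

Lemma crossNN u v : cross (- u) (- v) = cross u v.
Proof. by apply: row3P; rewrite !rowE; ring. Qed.

Lemma crossNl u v : cross (- u) v = - cross u v.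
Proof. by apply: row3P; rewrite !rowE; ring. Qed.

Lemma crossNr u v : cross u (- v) = - cross u v.
Proof. by apply: row3P; rewrite !rowE; ring. Qed.

Lemma cross_meet p l m : dot l p = 0 -> cross p (cross l m) = dot p m *: l.
Proof.
move=> h; have e : cross p (cross l m) = dot p m *: l - dot l p *: m.
  by apply: row3P; rewrite !rowE !dotE; ring.
by rewrite e h scale0r subr0.
Qed.

Lemma cross_meets l m q : cross (cross l m) (cross l q) = triple l m q *: l.
Proof.
by apply: row3P; rewrite !rowE /triple !dotE !crossE; ring.
Qed.

Lemma triple_lines a b c d f :
  triple (cross a b) (cross c d) (cross d f) = triple a b d * triple c d f.
Proof. by rewrite /triple !dotE !crossE; ring. Qed.

Lemma dotZ s t u v : dot (s *: u) (t *: v) = s * t * dot u v.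
Proof. by rewrite !dotE !rowE; ring. Qed.

Lemma dotC u v : dot u v = dot v u.
Proof. by rewrite !dotE; ring. Qed.

Lemma dot_eq0 u : dot u u = 0 -> u = 0.
Proof.
rewrite dotE => /eqP; rewrite -!expr2 !paddr_eq0 ?addr_ge0 ?sqr_ge0 //.
rewrite !expf_eq0 /= => /andP[/andP[/eqP h0 /eqP h1] /eqP h2].
by apply: row3P; rewrite ?h0 ?h1 ?h2 mxE.
Qed.

Lemma tripleZ s t r u v w :
  triple (s *: u) (t *: v) (r *: w) = s * t * r * triple u v w.
Proof. by rewrite /triple !dotE !rowE; ring. Qed.

Definition mxtriple M : R := triple (row 0 M) (row 1 M) (row 2%:R M).

Lemma tripleM u v w M :
  triple (u *m M) (v *m M) (w *m M) = triple u v w * mxtriple M.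
Proof.
rewrite /mxtriple /triple !dotE !crossE !mxE !sum3E; ring.
Qed.

Lemma mxtriple_neq0 M : M \in unitmx -> mxtriple M != 0.
Proof.
move=> uM; apply/eqP => h.
have := tripleM (row 0 (invmx M)) (row 1 (invmx M)) (row 2%:R (invmx M)) M.
rewrite h mulr0 -!row_mul mulVmx // /triple !dotE !crossE !mxE /=.
rewrite !(mulr0, mul0r, mulr1, subr0, addr0).
by rewrite add0r => /eqP; rewrite oner_eq0.
Qed.

Lemma chi_triple a b c d f : cross a b != 0 ->
  chi a b (meet_lines (line_through a b) (line_through c d))
          (meet_lines (line_through a b) (line_through d f)) =
  triple a b d * triple c d f / (triple c d a * triple d f b).
Proof.
move=> l0; rewrite /chi /cross_ratio /meet_lines /line_through.
set l := cross a b.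
have la : dot l a = 0 by rewrite /l dotE !crossE; ring.
have lb : dot l b = 0 by rewrite /l dotE !crossE; ring.
rewrite cross_meets triple_lines cross_meet // (crossC b a) -/l.
rewrite (crossC (cross l _) b) (cross_meet _ lb) -!scaleN1r scalerA !dotZ.
rewrite (dotC a) (dotC b) -/(triple c d a) -/(triple d f b).
have hN : dot l l != 0 by apply: contra_neq l0; exact: dot_eq0.
rewrite !mulN1r !mulrN !mulNr invrN mulrN opprK.
by rewrite -mulf_div divff // mulr1.
Qed.

Definition tratio a b c d f : R :=
  triple a b d * triple c d f / (triple c d a * triple d f b).

Lemma chi_triple' a b c d f : cross a b != 0 ->
  chi a b (meet_lines (line_through d c) (line_through b a))
          (meet_lines (line_through f d) (line_through b a)) =
  tratio a b c d f.
Proof.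
move=> l0; rewrite /tratio -(chi_triple c d f l0) /meet_lines /line_through /chi.
rewrite /cross_ratio (crossC d) (crossC b a) crossNN.
rewrite (crossC f) crossNN.
rewrite (crossC (cross c d)) (crossC (cross d f)).
rewrite crossNN !crossNr !crossNl !dotE !(rowNE,rowDE,rowZE).
by congr (_ / _); ring.
Qed.

Lemma tratio_equiv M a b c d f a' b' c' d' f' : M \in unitmx ->
  same_point (a *m M) a' -> same_point (b *m M) b' -> same_point (c *m M) c' ->
  same_point (d *m M) d' -> same_point (f *m M) f' ->
  tratio a b c d f = tratio a' b' c' d' f'.
Proof.
move=> /mxtriple_neq0 hM [ta na ->] [tb nb ->] [tc nc ->] [td nd ->] [tf nf ->].
rewrite /tratio !tripleZ !tripleM.
set X := triple a b d; set Y := triple c d f.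
set Z := triple c d a; set W := triple d f b.
have E1 : ta * tb * td * (X * mxtriple M) * (tc * td * tf * (Y * mxtriple M)) =
  (ta * tb * td * tc * td * tf * mxtriple M * mxtriple M) * (X * Y) by ring.
have E2 : tc * td * ta * (Z * mxtriple M) * (td * tf * tb * (W * mxtriple M)) =
  (ta * tb * td * tc * td * tf * mxtriple M * mxtriple M) * (Z * W) by ring.
by rewrite E1 E2 -[RHS]mulf_div divff ?mul1r // !mulf_neq0.
Qed.

Lemma crossl0 (v : 'rV[R]_3) : cross 0 v = 0.
Proof. by apply: row3P; rewrite !rowE !mxE; ring. Qed.

Lemma has_parity_shift e (I K : int) : ~~ odd `|K|%N ->
  has_parity e (I + K) = has_parity e I.
Proof. rewrite /has_parity; lia. Qed.

Lemma triple_neq0_equiv (M : 'M[R]_3) a b c a' b' c' : M \in unitmx ->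
  same_point (a *m M) a' -> same_point (b *m M) b' -> same_point (c *m M) c' ->
  triple a b c != 0 -> triple a' b' c' != 0.
Proof.
move=> /mxtriple_neq0 hM [ta na ->] [tb nb ->] [tc nc ->] h.
by rewrite tripleZ tripleM !mulf_neq0.
Qed.

Lemma triple_cross_neq0 (a b c : 'rV[R]_3) : triple a b c != 0 -> cross a b != 0.
Proof.
apply: contra_neq => h.
rewrite /triple h dotE !mxE; ring.
Qed.

Lemma tripleE21 (a b c : 'rV[R]_3) : triple a b c = triple c b a * -1.
Proof. by rewrite /triple !dotE !crossE; ring. Qed.

Lemma xcoord_tratio e n (A : polygon R) j : twisted e n A ->
  xcoord e A j = if has_parity e j
    then tratio (A (j - 4)) (A (j - 2)) (A j) (A (j + 2)) (A (j + 4))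
    else tratio (A (j + 3)) (A (j + 1)) (A (j - 1)) (A (j - 3)) (A (j - 5)).
Proof.
case=> gp _; rewrite /xcoord; case: (boolP (has_parity e j)) => pj /=.
  rewrite /tratio -chi_triple //; apply: (@triple_cross_neq0 _ _ (A j)).
  have pj4 : has_parity e (j - 4) by move: pj; rewrite /has_parity; lia.
  have [+ _ _ _] := gp _ pj4.
  rewrite (_ : j - 4 + 2 = j - 2); last by lia.
  rewrite (_ : j - 4 + 4 = j); last by lia.
  by move=> h; apply/eqP.
have pj1 : has_parity e (j - 1) by move: pj; rewrite /has_parity; lia.
have E4 : j - 1 + 4 = j + 3 by lia.
have E2 : j - 1 + 2 = j + 1 by lia.
have F2 : j - 1 - 2 = j - 3 by lia.
have F4 : j - 1 - 4 = j - 5 by lia.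
rewrite E4 E2 F2 F4 -chi_triple' //.
apply: (@triple_cross_neq0 _ _ (A (j - 1))).
have pj3 : has_parity e (j - 3) by move: pj; rewrite /has_parity; lia.
have [_ _ _] := gp _ pj3.
rewrite (_ : j - 3 + 2 = j - 1); last by lia.
rewrite (_ : j - 3 + 4 = j + 1); last by lia.
rewrite (_ : j - 3 + 6 = j + 3); last by lia.
move=> h; apply/eqP => h'; apply: h.
by rewrite /collinear /line_through -/(triple _ _ _) tripleE21 h' mul0r.
Qed.

Lemma xcoord_proj_equiv e n (A B : polygon R) j :
  twisted e n A -> twisted e n B -> proj_equiv e A B ->
  xcoord e A j = xcoord e B j.
Proof.
move=> tA tB [psi upsi h]; rewrite (xcoord_tratio j tA) (xcoord_tratio j tB).
case: ifP => pj; apply: (tratio_equiv upsi); apply: h; move: pj;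
  by rewrite /has_parity; lia.
Qed.
End Invariance.

(* Main.v *)
Require Import Defs.
From mathcomp Require Import all_boot all_order all_algebra.
From mathcomp Require Import ring zify lra mpoly.
From mathcomp Require Import boolp classical_sets reals.

Set Implicit Arguments.
Unset Strict Implicit.
Unset Printing Implicit Defensive.

Import Order.TTheory GRing.Theory Num.Theory.
Local Open Scope ring_scope.

(** On sequences of coordinates write u_a = x_(2a) and v_a = x_(2a+1). Up to a
    shift of the index by one at each iteration, the pentagram map is
      u_a |-> u_a g_(a-1) / g_(a+1),  v_a |-> v_(a+1) g_(a+2) / g_a
    with g_a = 1 - u_a v_a, and X_S is given by u_a v_a = 1 for the indices
    a = s, s + 2, ..., s + 2m - 2, where s = i - (m - 1). The coordinates of all
    iterates factor through one family of polynomials tau a l (the entry of row a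
    and layer l), with tau a 0 = tau a 1 = 1, tau a 2 = g_a and
      tau a (k+2) tau (a+1) k = tau a (k+1) tau (a+1) (k+1)
        - u_a v_(a+k) tau (a-1) (k+1) tau (a+2) (k+1);
    the coordinates of the k-th iterate are a coordinate of the first polygon
    times a quotient of entries of the layers k and k + 1 ([iter_step_coords]).
    So the theorem is a matter of which entries vanish on X_S.

    That the quotients defined by the recurrence are polynomials is a Laurent
    phenomenon: the recurrence makes an entry polynomial up to division by an
    earlier one, and [tau_step] identifies it with an entry of an earlier layer
    at the next iterate, which is polynomial up to division by factors g_b; the
    two denominators have no common factor ([tau_strip]).

    The locus X_S is irreducible ([paired_irreducible]): a product of polynomials
    vanishes on it only if one of the factors does. On X_S the entries of row s
    vanish in the layers 2, ..., m + 1 ([tau_first_row]), and in the layer m + 1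
    so do the m entries of rows s, ..., s + m - 1 ([tau_last_layer]). On the other
    hand no entry of the layers m + 2 and m + 3 vanishes identically
    ([nz_tau_layers]): an entry is affine in one of its variables, with a
    coefficient which is a monomial times an entry of the previous layer
    ([tau_affine]); around the zeros of the layer m + 1, where this argument is
    not available, the recurrence relates the nonvanishing of neighbouring
    entries ([nz_tau_next]). The entries in the rows just before s do not vanish
    identically either. An entry involves a window of indices whose length grows
    by 3 with each layer; up to the layer m + 3 it is at most n when 3m + 4 <= n,
    so that the periodicity of the coordinates of a twisted n-gon does not
    interfere ([nzp_tau]).

    For 1 <= k <= m + 1, one coordinate of the k-th iterate then has exactly one
    entry which vanishes on X_S, in its numerator or in its denominator. At a
    regular point the coordinates of the value are nonzero, so that no such
    cancellation is possible ([singular_iterate]). For k = m + 2 all entries in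
    the fractions are generically nonzero, and the values of these fractions are
    the coordinates of a polygon by [polygon_exists] ([regular_iterate]). Finally,
    where tau c (m+1) = 0, the recurrence becomes the equality of two products,
    which says that two consecutive coordinates of the value have product 1; for
    the m zeros of this layer these are the equations of Y_S' ([value_coords]). *)

(** * Polynomial functions of one variable *)

Section UnivariatePolynomials.
Variable R : numFieldType.
Implicit Types (p q : {poly R}) (t : R).

Lemma poly_nonroot p : p != 0 -> exists t, p.[t] != 0.
Proof.
move=> np; apply: contrapT => H.
have h t : p.[t] = 0 by apply: contrapT => h; apply: H; exists t; apply/eqP.
move/eqP: np; apply.
apply: (@roots_geq_poly_eq0 R p [seq i%:R | i <- iota 0 (size p)]).
- by apply/allP => t /mapP[i _ ->]; rewrite rootE h.
- by rewrite map_inj_uniq ?iota_uniq // => i j /eqP; rewrite eqr_nat => /eqP.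
- by rewrite size_map size_iota.
Qed.

Definition polynomial_map (f : R -> R) := exists p, forall t, f t = p.[t].

Lemma polynomial_map_cst (c : R) : polynomial_map (fun _ => c).
Proof. by exists c%:P => t; rewrite hornerC. Qed.

Lemma polynomial_map_id : polynomial_map id.
Proof. by exists 'X => t; rewrite hornerX. Qed.

Lemma polynomial_mapD f g : polynomial_map f -> polynomial_map g ->
  polynomial_map (fun t => f t + g t).
Proof. by move=> [p hp] [q hq]; exists (p + q) => t; rewrite hornerD hp hq. Qed.

Lemma polynomial_mapM f g : polynomial_map f -> polynomial_map g ->
  polynomial_map (fun t => f t * g t).
Proof. by move=> [p hp] [q hq]; exists (p * q) => t; rewrite hornerM hp hq. Qed.

Lemma polynomial_mapN f : polynomial_map f -> polynomial_map (fun t => - f t).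
Proof. by move=> [p hp]; exists (- p) => t; rewrite hornerN hp. Qed.

Lemma polynomial_mapB f g : polynomial_map f -> polynomial_map g ->
  polynomial_map (fun t => f t - g t).
Proof. by move=> hf hg; apply: polynomial_mapD => //; apply: polynomial_mapN. Qed.

Lemma polynomial_map_prod (J : Type) (s : seq J) (F : J -> R -> R) :
  (forall j, polynomial_map (F j)) ->
  polynomial_map (fun t => \prod_(j <- s) F j t).
Proof.
move=> hF; elim: s => [|j s [p hp]].
  by exists 1 => t; rewrite big_nil hornerC.
by have [q hq] := hF j; exists (q * p) => t; rewrite big_cons hornerM hp hq.
Qed.

Lemma polynomial_map_cancel f g t0 : polynomial_map f -> polynomial_map g ->
  (forall t, f t * g t = 0) -> g t0 != 0 -> forall t, f t = 0.
Proof.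
move=> [p hp] [q hq] h gt0 t; rewrite hp.
suff -> : p = 0 by rewrite horner0.
apply: contrapT => /eqP np.
have nq : q != 0 by apply: contra_neq gt0 => q0; rewrite hq q0 horner0.
have [s] := poly_nonroot (mulf_neq0 np nq).
by rewrite hornerM -hp -hq h eqxx.
Qed.

Lemma polynomial_map_nonroot f g t0 t1 : polynomial_map f -> polynomial_map g ->
  f t0 != 0 -> g t1 != 0 -> exists t, f t * g t != 0.
Proof.
move=> pf pg f0 g1; apply: contrapT => H.
have h t : f t * g t = 0 by apply: contrapT => h; apply: H; exists t; apply/eqP.
by move: f0; rewrite (polynomial_map_cancel pf pg h g1) eqxx.
Qed.
End UnivariatePolynomials.

(** * Polynomial functions of many variables *)

Section PolynomialFunctions.
Variables (R : numFieldType).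

(** Polynomial functions of an arbitrary, possibly infinite, family of
    variables. They are generated inductively, so that a property of all of
    them is proved without any normal form. *)
Inductive polyfun (I : Type) : ((I -> R) -> R) -> Prop :=
| polyfun_cst c : polyfun (fun _ => c)
| polyfun_var i : polyfun (fun x => x i)
| polyfunD f g : polyfun f -> polyfun g -> polyfun (fun x => f x + g x)
| polyfunM f g : polyfun f -> polyfun g -> polyfun (fun x => f x * g x).

Variable I : Type.
Implicit Types (x y : I -> R) (f g : (I -> R) -> R).

Lemma polyfunN f : polyfun f -> polyfun (fun x => - f x).
Proof.
move=> pf; rewrite (_ : (fun _ => _) = fun x => -1 * f x).
  by apply: polyfunM => //; apply: polyfun_cst.
by apply: funext => x; rewrite mulN1r.
Qed.

Lemma polyfunB f g : polyfun f -> polyfun g -> polyfun (fun x => f x - g x).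
Proof. by move=> pf pg; apply: polyfunD => //; apply: polyfunN. Qed.

Lemma polyfun_prod (J : Type) (s : seq J) (F : J -> (I -> R) -> R) :
  (forall j, polyfun (F j)) -> polyfun (fun x => \prod_(j <- s) F j x).
Proof.
move=> hF; elim: s => [|j s IH].
  rewrite (_ : (fun _ => _) = fun _ => 1); first exact: polyfun_cst.
  by apply: funext => x; rewrite big_nil.
rewrite (_ : (fun _ => _) = fun x => F j x * \prod_(k <- s) F k x).
  exact: polyfunM.
by apply: funext => x; rewrite big_cons.
Qed.

Lemma polyfunX f d : polyfun f -> polyfun (fun x => f x ^+ d).
Proof.
move=> pf; elim: d => [|d IH].
  by rewrite (_ : (fun _ => _) = fun _ => 1) //; apply: polyfun_cst.
rewrite (_ : (fun _ => _) = fun x => f x * f x ^+ d); first exact: polyfunM.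
by apply: funext => x; rewrite exprS.
Qed.

Lemma polyfun_comp (J : Type) (h : (J -> R) -> I -> R) f :
  (forall i, polyfun (fun z => h z i)) -> polyfun f -> polyfun (fun z => f (h z)).
Proof.
move=> ph; elim=> [c|i|f1 f2 _ p1 _ p2|f1 f2 _ p1 _ p2] //.
- exact: polyfun_cst.
- exact: polyfunD.
- exact: polyfunM.
Qed.

Lemma polyfun_curve (c : R -> I -> R) f :
  (forall i, polynomial_map (fun t => c t i)) -> polyfun f ->
  polynomial_map (fun t => f (c t)).
Proof.
move=> pc; elim=> [k|i|f1 f2 _ p1 _ p2|f1 f2 _ p1 _ p2] //.
- exact: polynomial_map_cst.
- exact: polynomial_mapD.
- exact: polynomial_mapM.
Qed.

Lemma polyfun_ray x f :
  polyfun f -> polynomial_map (fun t => f (fun i => t * x i)).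
Proof.
apply: polyfun_curve => i; apply: polynomial_mapM; first exact: polynomial_map_id.
exact: polynomial_map_cst.
Qed.

Lemma ray1 x : (fun i => 1 * x i) = x.
Proof. by apply: funext => i; rewrite mul1r. Qed.

Lemma ray0 x : (fun i => 0 * x i) = fun => 0.
Proof. by apply: funext => i; rewrite mul0r. Qed.

(** A factor which does not vanish at the origin does not vanish identically
    on any ray, hence can be simplified. *)
Lemma polyfun_cancel f g : polyfun f -> polyfun g ->
  (forall x, f x * g x = 0) -> g (fun => 0) != 0 -> forall x, f x = 0.
Proof.
move=> pf pg h g0 x; rewrite -(ray1 x).
apply: (@polynomial_map_cancel _ _ _ 0 (polyfun_ray x pf) (polyfun_ray x pg)).
  by move=> t; apply: h.
by rewrite ray0.
Qed.
End PolynomialFunctions.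
Arguments polyfun_cst {R I}.
Arguments polyfun_var {R I}.

(** * Loci where pairs of coordinates have product 1 *)

Section PairedCoordinates.
Variables (R : numFieldType) (I : Type).
Variables (P : I -> bool) (tau sigma : I -> I).
Hypotheses (tauK : cancel tau sigma) (sigmaK : cancel sigma tau).
Hypothesis Ptau : forall i, P i -> ~~ P (tau i).

Definition paired (x : I -> R) := forall i, P i -> x i * x (tau i) = 1.

Let segment (x y : I -> R) t i := (1 - t) * x i + t * y i.

Let arc x y t i :=
  if P i then if segment x y t i == 0 then 1 else segment x y t i
  else if P (sigma i) then
    if segment x y t (sigma i) == 0 then 1 else (segment x y t (sigma i))^-1
  else segment x y t i.

Let arc_paired x y t : paired (arc x y t).
Proof.
move=> i Pi; rewrite /arc Pi (negPf (Ptau Pi)) tauK Pi.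
by case: eqP => [_|/eqP h]; rewrite ?mulr1 // divff.
Qed.

Let segment_poly x y i : polynomial_map (fun t => segment x y t i).
Proof.
rewrite /segment; apply: polynomial_mapD; apply: polynomial_mapM;
  try exact: polynomial_map_cst.
- apply: polynomial_mapB; first exact: polynomial_map_cst.
  exact: polynomial_map_id.
- exact: polynomial_map_id.
Qed.

Let paired_neq0 x i : paired x -> P i -> x i != 0.
Proof.
by move=> px Pi; apply/eqP => h; move: (px i Pi); rewrite h mul0r => /eqP;
  rewrite eq_sym oner_eq0.
Qed.

Let arc0 x y : paired x -> arc x y 0 = x.
Proof.
move=> px; apply: funext => i; rewrite /arc /segment !subr0 !mul1r !mul0r !addr0.
case: ifP => [Pi|_]; first by rewrite (negPf (paired_neq0 px Pi)).
case: ifP => [Pi|_] //; rewrite (negPf (paired_neq0 px Pi)).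
apply: (mulfI (paired_neq0 px Pi)); rewrite divff ?(paired_neq0 px Pi) //.
by have := px _ Pi; rewrite sigmaK.
Qed.

Let arc1 x y : paired y -> arc x y 1 = y.
Proof.
move=> px; apply: funext => i; rewrite /arc /segment !subrr !mul1r !mul0r !add0r.
case: ifP => [Pi|_]; first by rewrite (negPf (paired_neq0 px Pi)).
case: ifP => [Pi|_] //; rewrite (negPf (paired_neq0 px Pi)).
apply: (mulfI (paired_neq0 px Pi)); rewrite divff ?(paired_neq0 px Pi) //.
by have := px _ Pi; rewrite sigmaK.
Qed.

Let arc_polyfun x y f : paired x -> paired y -> polyfun f ->
  exists w p : R -> R, [/\ polynomial_map w, polynomial_map p,
    w 0 != 0, w 1 != 0 & forall t, w t != 0 -> f (arc x y t) * w t = p t].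
Proof.
move=> px py; elim=> [c|i|f1 f2 _ IH1 _ IH2|f1 f2 _ IH1 _ IH2].
- exists (fun _ => 1), (fun _ => c); split; rewrite ?oner_neq0 //;
    try exact: polynomial_map_cst.
  by move=> t _; rewrite mulr1.
- case Pi: (P i).
    exists (fun t => segment x y t i), (fun t => segment x y t i * segment x y t i).
    split; [exact: segment_poly|by apply: polynomial_mapM|..].
    + by rewrite /segment subr0 mul1r mul0r addr0 paired_neq0.
    + by rewrite /segment subrr mul0r mul1r add0r paired_neq0.
    + by move=> t; rewrite /arc Pi => /negPf ->.
  case Psi: (P (sigma i)).
    exists (fun t => segment x y t (sigma i)), (fun _ => 1).
    split; [exact: segment_poly|exact: polynomial_map_cst|..].
    + by rewrite /segment subr0 mul1r mul0r addr0 paired_neq0.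
    + by rewrite /segment subrr mul0r mul1r add0r paired_neq0.
    + by move=> t h; rewrite /arc Pi Psi (negPf h) mulVf.
  exists (fun _ => 1), (fun t => segment x y t i); split; rewrite ?oner_neq0 //;
    [exact: polynomial_map_cst|by move=> t _; rewrite /arc Pi Psi mulr1].
- have [w1 [p1 [pw1 pp1 w10 w11 h1]]] := IH1.
  have [w2 [p2 [pw2 pp2 w20 w21 h2]]] := IH2.
  exists (fun t => w1 t * w2 t), (fun t => p1 t * w2 t + p2 t * w1 t).
  split; rewrite ?mulf_neq0 //; first exact: polynomial_mapM.
    by apply: polynomial_mapD; apply: polynomial_mapM.
  by move=> t; rewrite mulf_eq0 negb_or => /andP[/h1 <- /h2 <-]; ring.
- have [w1 [p1 [pw1 pp1 w10 w11 h1]]] := IH1.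
  have [w2 [p2 [pw2 pp2 w20 w21 h2]]] := IH2.
  exists (fun t => w1 t * w2 t), (fun t => p1 t * p2 t).
  split; rewrite ?mulf_neq0 //; try exact: polynomial_mapM.
  by move=> t; rewrite mulf_eq0 negb_or => /andP[/h1 <- /h2 <-]; ring.
Qed.

(** The locus where prescribed disjoint pairs of coordinates have product 1 is
    irreducible: two of its points are joined by a rational curve in it, on
    which each coordinate of a pair is affine or the inverse of an affine
    function, and a univariate polynomial has finitely many zeros. *)
Lemma paired_irreducible f g : polyfun f -> polyfun g ->
  (exists x, paired x /\ f x != 0) -> (exists x, paired x /\ g x != 0) ->
  exists x, paired x /\ f x * g x != 0.
Proof.
move=> pf pg [x [px fx]] [y [py gy]].
have [w1 [p1 [pw1 pp1 w10 w11 h1]]] := arc_polyfun px py pf.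
have [w2 [p2 [pw2 pp2 w20 w21 h2]]] := arc_polyfun px py pg.
have a0 : p1 0 * w1 0 * w2 0 != 0.
  by rewrite -(h1 0 w10) (arc0 y px) !mulf_neq0.
have a1 : p2 1 != 0 by rewrite -(h2 1 w21) (arc1 x py) mulf_neq0.
have pa : polynomial_map (fun t => p1 t * w1 t * w2 t).
  by do 2 apply: polynomial_mapM => //.
have [t] := polynomial_map_nonroot pa pp2 a0 a1.
move=> h; exists (arc x y t); split; first exact: arc_paired.
have [w1t w2t] : w1 t != 0 /\ w2 t != 0.
  by move: h; rewrite !mulf_eq0 !negb_or => /andP[/andP[/andP[_ ->] ->]].
apply: contra_neq h => h; rewrite -(h1 t) // -(h2 t) //.
have -> : f (arc x y t) * w1 t * w1 t * w2 t * (g (arc x y t) * w2 t) =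
  f (arc x y t) * g (arc x y t) * (w1 t * w1 t * w2 t * w2 t) by ring.
by rewrite h mul0r.
Qed.
End PairedCoordinates.

(** * Divisibility by 1 - x_i x_j *)

Section Division.
Variables (R : numFieldType) (I : eqType).
Implicit Types (x y : I -> R) (f g : (I -> R) -> R) (i : I).

Definition upd x i t : I -> R := fun j => if j == i then t else x j.

Lemma updE x i t : upd x i t i = t. Proof. by rewrite /upd eqxx. Qed.

Lemma updF x i t j : j != i -> upd x i t j = x j.
Proof. by rewrite /upd => /negPf ->. Qed.

Lemma upd_id x i : upd x i (x i) = x.
Proof. by apply: funext => j; rewrite /upd; case: eqP => [->|]. Qed.

Lemma upd_poly x i j : polynomial_map (fun t => upd x i t j).
Proof.
rewrite /upd; case: eqP => _; first exact: polynomial_map_id.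
exact: polynomial_map_cst.
Qed.

Lemma polyfun_upd_poly f x i : polyfun f -> polynomial_map (fun t => f (upd x i t)).
Proof. by apply: polyfun_curve => j; apply: upd_poly. Qed.

(** A coordinate is not a zero divisor. *)
Lemma polyfun_eq0_off f i : polyfun f -> (forall x, x i != 0 -> f x = 0) ->
  forall x, f x = 0.
Proof.
move=> pf h x; rewrite -(upd_id x i).
apply: (@polynomial_map_cancel _ _ id 1 (polyfun_upd_poly x i pf)).
- exact: polynomial_map_id.
- move=> t; case: (eqVneq t 0) => [->|t0]; first by rewrite mulr0.
  by rewrite h ?mul0r // updE.
- exact: oner_neq0.
Qed.

Lemma polyfun_upd_cst f i c : polyfun f -> polyfun (fun x => f (upd x i c)).
Proof.
apply: polyfun_comp => j; rewrite /upd; case: (j == i).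
  exact: polyfun_cst.
exact: polyfun_var.
Qed.

Lemma polyfun_taylor f i : polyfun f ->
  exists g, polyfun g /\ forall x, f x = f (upd x i 0) + x i * g x.
Proof.
elim=> [c|j|f1 f2 p1 [g1 [pg1 h1]] p2 [g2 [pg2 h2]]
       |f1 f2 p1 [g1 [pg1 h1]] p2 [g2 [pg2 h2]]].
- by exists (fun _ => 0); split=> [|x]; [exact: polyfun_cst|rewrite mulr0 addr0].
- case: (eqVneq j i) => [->|ji].
    exists (fun _ => 1); split=> [|x]; first exact: polyfun_cst.
    by rewrite updE mulr1 add0r.
  exists (fun _ => 0); split=> [|x]; first exact: polyfun_cst.
  by rewrite updF // mulr0 addr0.
- exists (fun x => g1 x + g2 x); split=> [|x]; first exact: polyfunD.
  by rewrite {1}h1 {1}h2; ring.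
- exists (fun x => f1 x * g2 x + g1 x * f2 (upd x i 0)); split=> [|x].
    apply: polyfunD; apply: polyfunM => //; exact: polyfun_upd_cst.
  by rewrite [in LHS]h2 mulrDr {1}h1; ring.
Qed.

(** Modulo 1 - x_i x_j a monomial in x_i and x_j becomes, once multiplied by
    a large power of x_i, a power of x_i. *)
Lemma polyfun_reduce f i j : i != j -> polyfun f ->
  exists d r q, [/\ polyfun r, polyfun q,
    forall x t, r (upd x j t) = r x &
    forall x, x i ^+ d * f x = r x + (1 - x i * x j) * q x].
Proof.
move=> ij; elim=> [c|k|f1 f2 p1 IH1 p2 IH2|f1 f2 p1 IH1 p2 IH2].
- exists 0%N, (fun _ => c), (fun _ => 0); split=> //; try exact: polyfun_cst.
  by move=> x; ring.
- case: (eqVneq k j) => [->|kj].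
    exists 1%N, (fun _ => 1), (fun _ => -1); split=> //; try exact: polyfun_cst.
    by move=> x; ring.
  exists 0%N, (fun x => x k), (fun _ => 0); split; try exact: polyfun_cst.
  + exact: polyfun_var.
  + by move=> x t; rewrite updF.
  + by move=> x; ring.
- have [d1 [r1 [q1 [pr1 pq1 i1 h1]]]] := IH1.
  have [d2 [r2 [q2 [pr2 pq2 i2 h2]]]] := IH2.
  have pX d := polyfunX d (polyfun_var i).
  exists (d1 + d2)%N, (fun x => x i ^+ d2 * r1 x + x i ^+ d1 * r2 x),
    (fun x => x i ^+ d2 * q1 x + x i ^+ d1 * q2 x).
  split; try by apply: polyfunD; apply: polyfunM.
    by move=> x t; rewrite i1 i2 updF.
  move=> x; rewrite exprD.
  transitivity (x i ^+ d2 * (x i ^+ d1 * f1 x) + x i ^+ d1 * (x i ^+ d2 * f2 x)).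
    by ring.
  by rewrite h1 h2; ring.
- have [d1 [r1 [q1 [pr1 pq1 i1 h1]]]] := IH1.
  have [d2 [r2 [q2 [pr2 pq2 i2 h2]]]] := IH2.
  exists (d1 + d2)%N, (fun x => r1 x * r2 x), (fun x =>
    (r1 x * q2 x + q1 x * r2 x) + (1 - x i * x j) * (q1 x * q2 x)); split.
  + exact: polyfunM.
  + apply: polyfunD; first by apply: polyfunD; apply: polyfunM.
    apply: polyfunM; last exact: polyfunM.
    apply: polyfunB; first exact: polyfun_cst.
    by apply: polyfunM; apply: polyfun_var.
  + by move=> x t; rewrite i1 i2.
  + move=> x; rewrite exprD.
    transitivity ((x i ^+ d1 * f1 x) * (x i ^+ d2 * f2 x)); first by ring.
    by rewrite h1 h2; ring.
Qed.

(** The remainder of [polyfun_reduce] does not depend on x_j, which may be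
    taken to be 1 / x_i, so that the remainder vanishes with f. The power of x_i
    is simplified as 1 - x_i x_j is 1 where x_i = 0. *)
Lemma polyfun_div f i j : i != j -> polyfun f ->
  (forall x, x i * x j = 1 -> f x = 0) ->
  exists g, polyfun g /\ forall x, f x = (1 - x i * x j) * g x.
Proof.
move=> ij pf f0; have [d [r [q [pr pq ir h]]]] := polyfun_reduce ij pf.
have r0 x : r x = 0.
  apply: (polyfun_eq0_off (i := i) pr) => {}x xi.
  rewrite -(ir x (x i)^-1).
  have := h (upd x j (x i)^-1).
  by rewrite updE updF // f0 ?mulr0 ?divff // ?subrr ?mul0r ?addr0 // updE updF // divff.
have {r0}h x : x i ^+ d * f x = (1 - x i * x j) * q x by rewrite h r0 add0r.
elim: d q pq h => [|d IH] q pq h.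
  by exists q; split=> // x; rewrite -h mul1r.
have [g [pg hg]] := polyfun_taylor i pq.
have q0 x : q (upd x i 0) = 0.
  by have := h (upd x i 0); rewrite !updE exprS !mul0r subr0 mul1r.
apply: (IH g pg) => x; apply/eqP; rewrite -subr_eq0; apply/eqP; move: x.
apply: (polyfun_eq0_off (i := i)) => [|x xi].
  apply: polyfunB; apply: polyfunM => //; first exact: polyfunX (polyfun_var i).
  apply: polyfunB; first exact: polyfun_cst.
  by apply: polyfunM; apply: polyfun_var.
apply: (mulfI xi); rewrite mulr0 mulrBr mulrA -exprS h hg q0; ring.
Qed.
End Division.

(** * The pentagram map on sequences of coordinates *)

Section Sequences.
Variable R : numFieldType.
Implicit Types (x y : int -> R) (a b c s : int).

Definition uc x a := x (2 * a).
Definition vc x a := x (2 * a + 1).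
Definition gap x a := 1 - uc x a * vc x a.

Lemma polyfun_uc a : polyfun (uc^~ a). Proof. exact: polyfun_var. Qed.
Lemma polyfun_vc a : polyfun (vc^~ a). Proof. exact: polyfun_var. Qed.

Lemma polyfun_gap a : polyfun (gap^~ a).
Proof.
apply: polyfunB; first exact: polyfun_cst.
by apply: polyfunM; [apply: polyfun_uc|apply: polyfun_vc].
Qed.

(** The pentagram map. In the sequence of the l-th iterate, the index J carries
    the coordinate x_(J+l): after this shift, the formulas for polygons indexed
    by Z and by 1/2 + Z coincide. *)
Definition step x (J : int) : R :=
  let a := (J %/ 2)%Z in
  if (2 %| J)%Z then uc x a * gap x (a - 1) / gap x (a + 1)
  else vc x (a + 1) * gap x (a + 2) / gap x a.

Lemma uc_step x a : uc (step x) a = uc x a * gap x (a - 1) / gap x (a + 1).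
Proof.
rewrite /uc /step (_ : (2 %| 2 * a)%Z = true); last by lia.
by rewrite (_ : (2 * a %/ 2)%Z = a) //; lia.
Qed.

Lemma vc_step x a : vc (step x) a = vc x (a + 1) * gap x (a + 2) / gap x a.
Proof.
rewrite {1}/vc /step (_ : (2 %| 2 * a + 1)%Z = false); last by lia.
by rewrite (_ : ((2 * a + 1) %/ 2)%Z = a) //; lia.
Qed.

(** The equations of X_S. *)
Definition sing (S : int -> bool) x := forall a, S a -> uc x a * vc x a = 1.

Definition nonzero_on S (f : (int -> R) -> R) := exists x, sing S x /\ f x != 0.

(** Genericity on the locus: finitely many polynomials, none of which vanishes
    identically on it, are nonzero at a common point. *)
Lemma sing_irreducible S f g : polyfun f -> polyfun g ->
  nonzero_on S f -> nonzero_on S g -> nonzero_on S (fun x => f x * g x).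
Proof.
pose P (J : int) := (2 %| J)%Z && S (J %/ 2)%Z.
have E x : sing S x <-> paired P (fun J : int => J + 1) x.
  split=> h => [J /andP[dJ SJ]|a Sa].
    by have := h _ SJ; rewrite /uc /vc (_ : 2 * (J %/ 2)%Z = J) //; lia.
  apply: (h (2 * a)); rewrite /P (_ : (2 %| 2 * a)%Z = true); last by lia.
  by rewrite (_ : (2 * a %/ 2)%Z = a) //; lia.
move=> pf pg [x [/E sx fx]] [y [/E sy gy]].
have K1 : cancel (fun J : int => J + 1) (fun J : int => J - 1) by move=> J; lia.
have K2 : cancel (fun J : int => J - 1) (fun J : int => J + 1) by move=> J; lia.
have D J : P J -> ~~ P (J + 1).
  by move=> /andP[dJ _]; rewrite /P (_ : (2 %| J + 1)%Z = false) //; lia.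
have [||z [/E sz fgz]] := paired_irreducible K1 K2 D pf pg.
- by exists x.
- by exists y.
- by exists z.
Qed.

(** A recurrence of the type of the Desnanot-Jacobi identity, whose solution
    factors the iterates of the pentagram map, see [iter_step_coords]. The
    bound K allows for a construction layer by layer. *)
Definition tau_system K (g : int -> nat -> (int -> R) -> R) :=
  [/\ forall c l, (l <= K)%N -> polyfun (g c l),
      forall c x, g c 0 x = 1,
      forall c x, g c 1 x = 1 &
      forall a k x, (k.+2 <= K)%N -> g a k.+2 x * g (a + 1) k x =
        g a k.+1 x * g (a + 1) k.+1 x -
        uc x a * vc x (a + k%:Z) * (g (a - 1) k.+1 x * g (a + 2) k.+1 x)].

End Sequences.
Arguments step {R} x J.

(** * The recurrence behind the iterates *)

Section TauSystem.
Variables (R : numFieldType) (K : nat) (g : int -> nat -> (int -> R) -> R).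
Hypothesis sys : tau_system K g.
Implicit Types (x y : int -> R) (a b c e s : int) (S : int -> bool).

Let gP c l : (l <= K)%N -> polyfun (g c l). Proof. by case: sys => H _ _ _; apply: H. Qed.
Let g0 c x : g c 0 x = 1. Proof. by case: sys. Qed.
Let g1 c x : g c 1 x = 1. Proof. by case: sys. Qed.
Let gR a k x : (k.+2 <= K)%N -> g a k.+2 x * g (a + 1) k x =
        g a k.+1 x * g (a + 1) k.+1 x -
        uc x a * vc x (a + k%:Z) * (g (a - 1) k.+1 x * g (a + 2) k.+1 x).
Proof. by case: sys => _ _ _; apply. Qed.

Lemma tau_gap c x : (2 <= K)%N -> g c 2 x = gap x c.
Proof. by move=> h; have := gR c x h; rewrite g0 !g1 !mulr1 addr0. Qed.

Lemma nat_ind2 (P : nat -> Prop) : P 0 -> P 1 ->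
  (forall k, P k -> P k.+1 -> P k.+2) -> forall k, P k.
Proof.
move=> h0 h1 h k; suff: P k /\ P k.+1 by case.
by elim: k => [|k [IH1 IH2]]; split=> //; apply: h.
Qed.

(** Hence no entry vanishes identically, and an entry is simplified by passing
    to a ray through the origin. *)
Lemma tau_at0 c l : (l <= K)%N -> g c l (fun => 0) = 1.
Proof.
move: l c; elim/nat_ind2 => [c|c|l IH1 IH2 c hl] //.
have /eqP := gR c (fun=> 0) hl.
rewrite IH1 1?ltnW 1?ltnW // mulr1 => /eqP ->; rewrite /uc mul0r mul0r subr0.
by rewrite !IH2 1?ltnW // mulr1.
Qed.

Let tau_ray c l x : (l <= K)%N -> polynomial_map (fun t => g c l (fun J => t * x J)).
Proof. by move=> hl; apply: polyfun_ray; apply: gP. Qed.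

Lemma tau_ray_cancel c l x (f : R -> R) : (l <= K)%N -> polynomial_map f ->
  (forall t, f t * g c l (fun J => t * x J) = 0) -> f 1 = 0.
Proof.
move=> hl pf h.
apply: (@polynomial_map_cancel _ _ _ 0 pf (tau_ray c x hl)) => //.
by rewrite ray0 tau_at0 // oner_neq0.
Qed.

Lemma tau_cancel c l f : (l <= K)%N -> polyfun f ->
  (forall x, f x * g c l x = 0) -> forall x, f x = 0.
Proof.
move=> hl pf h; apply: (polyfun_cancel pf (gP c hl) h).
by rewrite tau_at0 // oner_neq0.
Qed.

Definition agree_on (lo hi : int) x y := forall a, lo <= a <= hi ->
  uc x a = uc y a /\ vc x a = vc y a.

Lemma uc_ray t x a : uc (fun J => t * x J) a = t * uc x a. Proof. by []. Qed.
Lemma vc_ray t x a : vc (fun J => t * x J) a = t * vc x a. Proof. by []. Qed.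

(** The window grows by one index to the left and two to the right with each
    layer. It allows for the comparison of periodic sequences with arbitrary
    ones. *)
Lemma tau_local l c x y : (l <= K)%N ->
  agree_on (c - l%:Z + 2) (c + 2 * l%:Z - 4) x y -> g c l x = g c l y.
Proof.
elim/ltn_ind: l c x y => l IH c x y hl h.
case: l => [|[|l]] in IH hl h *; first by rewrite !g0.
  by rewrite !g1.
pose f t := g c l.+2 (fun J => t * x J) - g c l.+2 (fun J => t * y J).
suff /eqP : f 1 = 0 by rewrite /f !ray1 subr_eq0 => /eqP.
have lK : (l <= K)%N by lia.
apply: (@tau_ray_cancel (c + 1) l x f lK) => [|t].
  by apply: polynomial_mapB; apply: tau_ray; lia.
have E c' k : (k < l.+2)%N -> c - l.+2%:Z <= c' - k%:Z ->
    c' + 2 * k%:Z <= c + 2 * l.+2%:Z ->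
    g c' k (fun J => t * x J) = g c' k (fun J => t * y J).
  move=> hk h1 h2; apply: IH => //; first by lia.
  by move=> a ha; rewrite !uc_ray !vc_ray; case: (h a) => [|-> ->] //; lia.
rewrite /f mulrBl gR // [in X in _ - X](E (c + 1)) ?gR //; try lia.
rewrite !(E _ l.+1); try lia.
rewrite !uc_ray !vc_ray.
have [-> _] : uc x c = uc y c /\ vc x c = vc y c by apply: h; lia.
have [_ ->] : uc x (c + l%:Z) = uc y (c + l%:Z) /\ vc x (c + l%:Z) = vc y (c + l%:Z).
  by apply: h; lia.
by rewrite subrr.
Qed.

(** When u_a = 0 the recurrence expresses the equality of the ratios of
    consecutive entries in two neighbouring rows. *)
Lemma tau_row_eq a k x : (k < K)%N -> uc x a = 0 -> g a k.+1 x = g (a + 1) k x.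
Proof.
elim: k x => [|k IH] x hk ux; first by rewrite g1 g0.
pose f t := g a k.+2 (fun J => t * x J) - g (a + 1) k.+1 (fun J => t * x J).
suff /eqP : f 1 = 0 by rewrite /f !ray1 subr_eq0 => /eqP.
have lK : (k <= K)%N by lia.
apply: (@tau_ray_cancel (a + 1) k x f lK) => [|t].
  by apply: polynomial_mapB; apply: tau_ray; lia.
have ut : uc (fun J => t * x J) a = 0 by rewrite uc_ray ux mulr0.
rewrite /f mulrBl gR // ut !mul0r subr0 IH //; last by lia.
by rewrite mulrC subrr.
Qed.

Lemma tau_rows_eq a j k x : (k + j <= K)%N ->
  (forall b, a <= b < a + j%:Z -> uc x b = 0) ->
  g a (k + j) x = g (a + j%:Z) k x.
Proof.
elim: j a => [|j IH] a hk h; first by rewrite addn0 addr0.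
rewrite addnS tau_row_eq; [|by lia|by apply: h; lia].
rewrite IH; first by congr (g _ _ _); lia.
  by lia.
by move=> b hb; apply: h; lia.
Qed.

(** The monomial in [tau_affine]. *)
Fixpoint slope x c k : R :=
  if k is k'.+1 then - uc x c * vc x (c + k%:Z) * slope x (c + 2) k' else - uc x c.

Lemma polyfun_slope c k : polyfun (fun x => slope x c k).
Proof.
elim: k c => [|k IH] c; first by apply: polyfunN; apply: polyfun_uc.
by do 2 apply: polyfunM => //; [apply: polyfunN; apply: polyfun_uc|apply: polyfun_vc].
Qed.

Lemma slope_neq0 x c k : (forall a, c <= a -> uc x a != 0) ->
  (forall a, vc x a != 0) -> slope x c k != 0.
Proof.
move=> hu hv; elim: k c hu => [|k IH] c hu /=; first by rewrite oppr_eq0 hu.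
by rewrite !mulf_neq0 ?oppr_eq0 ?hu // IH // => a ha; apply: hu; lia.
Qed.

Definition updv x e t := upd x (2 * e + 1) t.

Lemma uc_updv x e t a : uc (updv x e t) a = uc x a.
Proof. by rewrite /uc /updv updF //; lia. Qed.

Lemma vc_updv x e t a : vc (updv x e t) a = if a == e then t else vc x a.
Proof.
rewrite /vc /updv; case: eqP => [->|ae]; first by rewrite updE.
by rewrite updF //; lia.
Qed.

Lemma updv_ray x e t r :
  (fun J => r * updv x e t J) = updv (fun J => r * x J) e (r * t).
Proof. by apply: funext => J; rewrite /updv /upd; case: eqP. Qed.

Lemma tau_updv_far l c x e t : (l <= K)%N -> c + 2 * l%:Z - 4 < e ->
  g c l (updv x e t) = g c l x.
Proof.
move=> hl he; apply: tau_local => // a ha; rewrite uc_updv vc_updv.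
by case: eqP => [|//]; lia.
Qed.

(** Among the v_b on which an entry depends, the one of largest index enters
    linearly: it enters a single factor on the right of the recurrence, whose
    coefficient is known by induction, and not the entry on the left by which one
    divides. *)
Lemma tau_affine k c x t : (k.+2 <= K)%N ->
  let e := c + 2 * k%:Z in
  g c k.+2 (updv x e t) =
    g c k.+2 x + (t - vc x e) * (slope x c k * g (c - 1) k.+1 x).
Proof.
elim: k c x t => [|k IH] c x t hk e.
  rewrite !tau_gap // /gap uc_updv vc_updv /e mulr0 addr0 eqxx g1 /=; ring.
pose f r := g c k.+3 (fun J => r * updv x e t J) - g c k.+3 (fun J => r * x J)
  - (r * t - r * vc x e) * (slope (fun J => r * x J) c k.+1 *
     g (c - 1) k.+2 (fun J => r * x J)).
suff /eqP : f 1 = 0.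
  by rewrite /f !ray1 !mul1r subr_eq0 subr_eq addrC => /eqP.
have lK : (k.+1 <= K)%N by lia.
apply: (@tau_ray_cancel (c + 1) k.+1 x f lK) => [|r].
  apply: polynomial_mapB; first by apply: polynomial_mapB; apply: tau_ray; lia.
  apply: polynomial_mapM; first apply: polynomial_mapB; try apply: polynomial_mapM;
    try exact: polynomial_map_id; try exact: polynomial_map_cst.
    by apply: (polyfun_ray x (polyfun_slope c k.+1)).
  by apply: tau_ray; lia.
rewrite /f updv_ray; set z := fun J => r * x J.
have far c' l : (l <= K)%N -> c' + 2 * l%:Z - 4 < e ->
    g c' l (updv z e (r * t)) = g c' l z by apply: tau_updv_far.
rewrite !mulrBl -{1}(far (c + 1) k.+1) //; last by rewrite /e; lia.
rewrite gR // (far c) ?(far (c + 1) k.+2) ?(far (c - 1)); try by rewrite /e; lia.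
rewrite gR // uc_updv vc_updv ifF; last by apply/eqP; rewrite /e; lia.
have -> : e = (c + 2) + 2 * k%:Z by rewrite /e; lia.
rewrite IH; last by lia.
rewrite (_ : c + 2 - 1 = c + 1); last by lia.
rewrite /= -[r * vc x _]/(vc z _).
by set A := slope _ _ _; ring.
Qed.

Definition sing_row lo hi S x := [/\ sing S x,
  forall a, lo <= a < hi -> uc x a = 0,
  forall a, ~~ (lo <= a < hi) -> uc x a != 0 & forall a, vc x a != 0].

Lemma sing_row_exists lo hi S : (forall a, lo <= a < hi -> ~~ S a) ->
  exists x, sing_row lo hi S x.
Proof.
move=> h; pose x (J : int) : R := ((2 %| J)%Z ==> ~~ (lo <= (J %/ 2)%Z < hi))%:R.
have ux a : uc x a = (~~ (lo <= a < hi))%:R.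
  rewrite /uc /x (_ : (2 %| 2 * a)%Z = true); last by lia.
  by rewrite (_ : (2 * a %/ 2)%Z = a) //; lia.
have vx a : vc x a = 1.
  by rewrite /vc /x (_ : (2 %| 2 * a + 1)%Z = false) //; lia.
exists x; split=> [a Sa|a ha|a ha|a].
- by rewrite ux vx mulr1; case: (boolP (lo <= a < hi)) => [/h|] //; rewrite Sa.
- by rewrite ux ha.
- by rewrite ux ha oner_neq0.
- by rewrite vx oner_neq0.
Qed.

(** The entries of the row hi, on sequences with u_(hi-1) = 0: then the slope
    of an entry is a monomial times the entry of this row two layers below, by
    [tau_row_eq], while the variable of largest index is free. *)
Lemma tau_nz_row lo hi S k : (k < K)%N -> lo < hi ->
  (forall a, lo <= a < hi -> ~~ S a) ->
  (forall j : nat, (j < k)%N -> ~~ S (hi + 2 * j%:Z)) ->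
  exists x, sing_row lo hi S x /\ g hi k.+1 x != 0.
Proof.
move=> hk lohi hS.
have main k0 x : (k0.+2 <= K)%N -> ~~ S (hi + 2 * k0%:Z) -> sing_row lo hi S x ->
    g (hi - 1) k0.+1 x != 0 -> exists y, sing_row lo hi S y /\ g hi k0.+2 y != 0.
  move=> hk0 hf hx gx; pose e := hi + 2 * k0%:Z.
  have [sx x0 ux vx] := hx.
  have B0 : slope x hi k0 * g (hi - 1) k0.+1 x != 0.
    by rewrite mulf_neq0 // slope_neq0 // => a ha; apply: ux; lia.
  have hy t : t != 0 -> sing_row lo hi S (updv x e t).
    move=> t0; split=> a; rewrite ?uc_updv ?vc_updv //.
    - by move=> Sa; rewrite ifF ?sx //; apply: contraTF Sa => /eqP ->.
    - by move=> /x0.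
    - by move=> /ux.
    - by case: ifP.
  case: (eqVneq (g hi k0.+2 (updv x e 1)) 0) => [h1|h1]; last first.
    by exists (updv x e 1); split=> //; apply: hy; apply: oner_neq0.
  (* A nonconstant affine function of t vanishes at most once, and t = 0 is
     excluded by the condition on the v_a. *)
  exists (updv x e 2); split; first by apply: hy; rewrite pnatr_eq0.
  apply: contra_neq B0 => h2; move: h1 h2; rewrite !tau_affine // => h1 h2.
  have := congr2 (fun p q => q - p) h1 h2; rewrite subr0 => <-; ring.
move: k hk; elim/nat_ind2 => [hk _|hk hf|k IH _ hk hf].
- have [x hx] := sing_row_exists hS; exists x; split=> //.
  by rewrite g1 oner_neq0.
- have [x hx] := sing_row_exists hS; apply: (main 0 x) => //; first exact: hf.
  by rewrite g1 oner_neq0.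
have [||x [hx gx]] := IH; first by lia.
  by move=> j hj; apply: hf; lia.
apply: (main k.+1 x) => //; first exact: hf.
have [_ x0 _ _] := hx.
by rewrite tau_row_eq ?subrK //; [lia|apply: x0; lia].
Qed.

Lemma tau_nz lo hi S c l : (l <= K)%N -> lo < hi -> lo <= c <= hi ->
  (forall a, lo <= a < hi -> ~~ S a) ->
  (forall j : nat, (j < l)%N -> ~~ S (hi + 2 * j%:Z)) -> nonzero_on S (g c l).
Proof.
move=> hl lohi /andP[hc1 hc2] hS hf; pose d := `|hi - c|%N.
have hd : hi = c + d%:Z by rewrite /d; lia.
case: (leqP l d) => hld.
  have [x hx] := sing_row_exists hS; exists x; split; first by case: hx.
  have [_ x0 _ _] := hx.
  rewrite -[l]add0n tau_rows_eq ?g0 ?oner_neq0 // => b hb; apply: x0; lia.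
have [k hk] : exists k, l = (k.+1 + d)%N by exists (l - d).-1; lia.
have [||x [hx gx]] := @tau_nz_row lo hi S k _ lohi hS; first by lia.
  by move=> j hj; apply: hf; lia.
exists x; split; first by case: hx.
have [_ x0 _ _] := hx.
by rewrite hk tau_rows_eq -?hd // -?hk // => b hb; apply: x0; lia.
Qed.

(** In the second layer this fails for c = s, where the entry is 1 - u_s v_s
    itself: divisions by entries of this layer need another argument, that of
    [tau_next3]. *)
Lemma tau_nz_single s c l : (3 <= l <= K)%N -> nonzero_on (pred1 s) (g c l).
Proof.
move=> /andP[l3 lK]; case: (ltgtP c s) => [cs|cs|->].
- apply: (@tau_nz (c - 1) (s - 1)) => //; try by lia.
  + by move=> a ha; apply/eqP; lia.
  + by move=> j _; apply/eqP; lia.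
- have [|x hx] := @sing_row_exists c (c + l%:Z) (pred1 s).
    by move=> a ha; apply/eqP; lia.
  exists x; split; first by case: hx.
  have [_ x0 _ _] := hx.
  by rewrite -[l]add0n tau_rows_eq ?g0 ?oner_neq0.
have [k hk] : exists k, l = k.+3 by exists (l - 3)%N; lia.
have [||||x [hx gx]] := @tau_nz_row (s - 2) (s - 1) (pred1 s) k.+1; try by lia.
- by move=> a ha; apply/eqP; lia.
- by move=> j _; apply/eqP; lia.
have [sx x0 ux vx] := hx; pose e := s + 2 * k.+1%:Z.
have B0 : slope x s k.+1 * g (s - 1) k.+2 x != 0.
  by rewrite mulf_neq0 // slope_neq0 // => a ha; apply: ux; lia.
have hy t : sing (pred1 s) (updv x e t).
  by move=> a /eqP ->; rewrite uc_updv vc_updv ifF ?sx //= /e; lia.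
rewrite hk; have hE t := tau_affine s x t (k := k.+1).
case: (eqVneq (g s k.+3 (updv x e 1)) 0) => [h1|h1]; last by exists (updv x e 1).
exists (updv x e 2); split=> //.
apply: contra_neq B0 => h2; move: h1 h2; rewrite !hE -?hk // => h1 h2.
have := congr2 (fun p q => q - p) h1 h2; rewrite subr0 => <-; ring.
Qed.

(** The sequences at which no denominator of [step] vanishes. *)
Definition good x := forall a, gap x a != 0.

Lemma polyfun_support f : @polyfun R int f -> exists B : nat, forall x y,
  (forall J : int, (`|J| < B)%N -> x J = y J) -> f x = f y.
Proof.
elim=> [c|J|f1 f2 _ [B1 h1] _ [B2 h2]|f1 f2 _ [B1 h1] _ [B2 h2]].
- by exists 0%N.
- by exists `|J|.+1 => x y; apply.
- by exists (B1 + B2)%N => x y h; rewrite (h1 x y) ?(h2 x y) // => J hJ; apply: h; lia.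
- by exists (B1 + B2)%N => x y h; rewrite (h1 x y) ?(h2 x y) // => J hJ; apply: h; lia.
Qed.

(** There are infinitely many conditions, but a polynomial function involves
    finitely many variables; when the others are set to 0 only finitely many
    conditions remain. *)
Lemma good_dense f : polyfun f -> (forall x, good x -> f x = 0) -> forall x, f x = 0.
Proof.
move=> pf h x; have [B hB] := polyfun_support pf.
pose z (J : int) := if (`|J| < B)%N then x J else 0.
rewrite (hB x z) => [|J hJ]; last by rewrite /z hJ.
rewrite -(ray1 z).
pose s : seq int := [seq i%:Z - B%:Z | i <- iota 0 (B + B)].
pose q t := \prod_(a <- s) gap (fun J => t * z J) a.
apply: (@polynomial_map_cancel _ _ q 0 (polyfun_ray z pf)).
- apply: polynomial_map_prod => a.
  exact: (polyfun_ray z (polyfun_gap R a)).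
- move=> t; case: (eqVneq (q t) 0) => [->|qt]; first by rewrite mulr0.
  rewrite h ?mul0r // => a.
  case: (boolP (a \in s)) => [sa|sa].
    by apply: contra_neq qt; rewrite /q (big_rem a sa) /= => ->; rewrite mul0r.
  have az : z (2 * a) = 0.
    rewrite /z; case: ifP => // hJ; case/negP: sa.
    apply/mapP; exists (absz (a + B%:Z)); last by lia.
    by rewrite mem_iota; lia.
  by rewrite /gap /uc az mulr0 mul0r subr0 oner_neq0.
- rewrite /q big1 ?oner_neq0 // => a _.
  by rewrite /gap /uc /vc !mul0r subr0.
Qed.

Lemma polyfun_step f : @polyfun R int f -> exists (s : seq int) p, polyfun p /\
  forall x, good x -> f (step x) * \prod_(a <- s) gap x a = p x.
Proof.
elim=> [c|J|f1 f2 _ [s1 [p1 [pp1 h1]]] _ [s2 [p2 [pp2 h2]]]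
       |f1 f2 _ [s1 [p1 [pp1 h1]]] _ [s2 [p2 [pp2 h2]]]].
- exists [::], (fun _ => c); split; first exact: polyfun_cst.
  by move=> x _; rewrite big_nil mulr1.
- case dJ: (2 %| J)%Z.
    exists [:: ((J %/ 2)%Z + 1)], (fun x => uc x (J %/ 2)%Z * gap x ((J %/ 2)%Z - 1)).
    split; first by apply: polyfunM; [apply: polyfun_uc|apply: polyfun_gap].
    by move=> x gx; rewrite /step dJ big_seq1 divfK.
  exists [:: (J %/ 2)%Z], (fun x => vc x ((J %/ 2)%Z + 1) * gap x ((J %/ 2)%Z + 2)).
  split; first by apply: polyfunM; [apply: polyfun_vc|apply: polyfun_gap].
  by move=> x gx; rewrite /step dJ big_seq1 divfK.
- have pg (r : seq int) := polyfun_prod r (fun a => polyfun_gap R a).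
  exists (s1 ++ s2), (fun x => p1 x * \prod_(a <- s2) gap x a +
    p2 x * \prod_(a <- s1) gap x a); split.
    by apply: polyfunD; apply: polyfunM.
  by move=> x gx; rewrite big_cat /= -h1 // -h2 //; ring.
- exists (s1 ++ s2), (fun x => p1 x * p2 x); split; first exact: polyfunM.
  by move=> x gx; rewrite big_cat /= -h1 // -h2 //; ring.
Qed.

Definition gaps x c l := \prod_(0 <= i < l) gap x (c + i%:Z).

Lemma gaps_recl x c l : gaps x c l.+1 = gap x c * gaps x (c + 1) l.
Proof.
rewrite /gaps big_nat_recl // addr0; congr (_ * _).
by apply: eq_bigr => i _; congr (gap _ _); lia.
Qed.

Lemma gaps_recr x c l : gaps x c l.+1 = gaps x c l * gap x (c + l%:Z).
Proof. by rewrite /gaps big_nat_recr. Qed.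

Lemma gaps_neq0 x c l : good x -> gaps x c l != 0.
Proof.
move=> gx; elim: l => [|l IH]; first by rewrite /gaps big_nil oner_neq0.
by rewrite gaps_recr mulf_neq0.
Qed.

Lemma polyfun_gaps c l : polyfun (fun x => gaps x c l).
Proof. by apply: polyfun_prod => i; apply: polyfun_gap. Qed.

Lemma gaps_wave x a j : gaps x a j.+1 * gaps x (a + 1) j.+1 =
  gaps x a j.+2 * gaps x (a + 1) j.
Proof.
rewrite (gaps_recr x (a + 1)) (gaps_recr x a j.+1).
by rewrite (_ : a + 1 + j%:Z = a + j.+1%:Z); [ring|lia].
Qed.

(** How the weights u_a v_(a+k) of the recurrence change under [step]. *)
Lemma gaps_wave2 x a j : good x -> uc x a * vc x (a + j.+1%:Z) *
    (gaps x (a - 1) j.+1 * gaps x (a + 2) j.+1) =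
  gaps x a j.+2 * gaps x (a + 1) j * (uc (step x) a * vc (step x) (a + j%:Z)).
Proof.
move=> gx; rewrite uc_step vc_step.
rewrite (_ : a + j%:Z + 1 = a + j.+1%:Z); last by lia.
rewrite (_ : a + j%:Z + 2 = a + j.+2%:Z); last by lia.
have E1 : gaps x (a - 1) j.+1 = gap x (a - 1) * gaps x a j.
  by rewrite gaps_recl subrK.
have E2 : gaps x (a + 2) j.+1 * gap x (a + 1) =
    gaps x (a + 1) j * gap x (a + j.+1%:Z) * gap x (a + j.+2%:Z).
  have := gaps_recl x (a + 1) j.+1; rewrite !gaps_recr.
  rewrite (_ : a + 1 + 1 = a + 2); last by lia.
  rewrite (_ : a + 1 + j%:Z = a + j.+1%:Z); last by lia.
  rewrite (_ : a + 1 + j.+1%:Z = a + j.+2%:Z); last by lia.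
  rewrite (_ : a + 2 + j%:Z = a + j.+2%:Z); last by lia.
  by move=> ->; ring.
have h1 := gx (a + 1); have h2 := gx (a + j%:Z).
apply: (mulIf (mulf_neq0 h1 h2)).
rewrite !(gaps_recr x a) E1.
transitivity (uc x a * vc x (a + j.+1%:Z) * gap x (a - 1) * gaps x a j *
  (gaps x (a + 2) j.+1 * gap x (a + 1)) * gap x (a + j%:Z)); first by ring.
by rewrite E2; field; rewrite h1 h2.
Qed.

(** Up to products of factors 1 - u_b v_b, the right-hand side of the recurrence
    is its right-hand side at the image of the pentagram map, one layer below;
    there the recurrence holds. *)
Lemma tau_step_rec a j x : (j.+2 <= K)%N -> good x ->
  (forall c, g c j.+1 x = gaps x c j * g c j (step x)) ->
  (forall c, g c j.+2 x = gaps x c j.+1 * g c j.+1 (step x)) ->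
  g a j.+2 x * g (a + 1) j.+2 x -
    uc x a * vc x (a + j.+1%:Z) * (g (a - 1) j.+2 x * g (a + 2) j.+2 x) =
  gaps x a j.+2 * g a j.+2 (step x) * g (a + 1) j.+1 x.
Proof.
move=> hj gx h1 h2; rewrite !h2 h1.
transitivity (gaps x a j.+1 * gaps x (a + 1) j.+1 *
    (g a j.+1 (step x) * g (a + 1) j.+1 (step x)) -
  uc x a * vc x (a + j.+1%:Z) * (gaps x (a - 1) j.+1 * gaps x (a + 2) j.+1) *
    (g (a - 1) j.+1 (step x) * g (a + 2) j.+1 (step x))); first by ring.
rewrite gaps_wave gaps_wave2 //.
transitivity (gaps x a j.+2 * gaps x (a + 1) j *
    (g a j.+2 (step x) * g (a + 1) j (step x))).
  by rewrite gR //; ring.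
by ring.
Qed.

(** Advancing by one iterate removes one layer: the recurrence determines the
    next entry on both sides, in the same way by [tau_step_rec]. *)
Lemma tau_step l c x : (l < K)%N -> good x -> g c l.+1 x = gaps x c l * g c l (step x).
Proof.
move: l c x; elim/nat_ind2 => [c x hl gx|c x hl gx|l IH1 IH2 c x hl gx].
- by rewrite g1 g0 /gaps big_nil mulr1.
- by rewrite tau_gap // g1 mulr1 gaps_recr /gaps big_nil mul1r addr0.
have l2 : (l.+2 <= K)%N by lia.
have [s [p [pp hp]]] := polyfun_step (gP c l2).
have W0 y : good y -> \prod_(a <- s) gap y a != 0.
  by move=> gy; rewrite prodf_seq_neq0; apply/allP => a _; rewrite gy.
pose f y := g c l.+3 y * \prod_(a <- s) gap y a - gaps y c l.+2 * p y.
have pf : polyfun f.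
  apply: polyfunB; apply: polyfunM => //; first exact: gP.
    by apply: polyfun_prod => a; apply: polyfun_gap.
  exact: polyfun_gaps.
suff /(_ x)/eqP f0 : forall y, f y = 0.
  by move: f0; rewrite subr_eq0 -hp // mulrA => /eqP/(mulIf (W0 x gx)).
have l1 : (l.+1 <= K)%N by lia.
apply: (tau_cancel (c := c + 1) l1 pf).
apply: good_dense; first by apply: polyfunM => //; exact: gP.
move=> y gy; rewrite /f -hp // mulrA -mulrBl.
rewrite mulrAC mulrBl gR // -tau_step_rec ?subrr ?mul0r //.
- by move=> d; apply: IH1 => //; lia.
- by move=> d; apply: IH2 => //; lia.
Qed.

Lemma polyfun_layer a k : (k.+1 <= K)%N -> polyfun (fun x =>
  g a k.+1 x * g (a + 1) k.+1 x -
    uc x a * vc x (a + k%:Z) * (g (a - 1) k.+1 x * g (a + 2) k.+1 x)).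
Proof.
move=> hk; apply: polyfunB; first by apply: polyfunM; apply: gP.
apply: polyfunM; last by apply: polyfunM; apply: gP.
by apply: polyfunM; [apply: polyfun_uc|apply: polyfun_vc].
Qed.

(** A factor 1 - u_s v_s of a polynomial multiple of an entry divides the
    cofactor of this entry, as the hypersurface u_s v_s = 1 is irreducible and
    does not lie in the zero locus of the entry. *)
Lemma tau_strip (r : seq int) c l (q N : (int -> R) -> R) : (3 <= l <= K)%N ->
  polyfun q -> polyfun N ->
  (forall x, q x * g c l x = \prod_(b <- r) gap x b * N x) ->
  exists f, polyfun f /\ forall x, f x * g c l x = N x.
Proof.
move=> hl pq pN; have lK : (l <= K)%N by case/andP: hl.
elim: r q pq => [|b r IH] q pq h.
  by exists q; split=> // x; rewrite h big_nil mul1r.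
have pr := polyfun_prod r (fun a => polyfun_gap R a).
have q0 x : uc x b * vc x b = 1 -> q x = 0.
  move=> xb; apply: contrapT => /eqP qx.
  have nq : nonzero_on (pred1 b) q by exists x; split=> // a /eqP ->.
  have [y [sy]] := sing_irreducible pq (gP c lK) nq (tau_nz_single b c hl).
  by rewrite h big_cons /gap (sy b) //= ?subrr ?mul0r ?mul0r ?eqxx.
have bb : 2 * b != 2 * b + 1 by lia.
have [q' [pq' hq']] := polyfun_div bb pq q0.
apply: (IH q' pq') => x; apply/eqP; rewrite -subr_eq0; apply/eqP; move: x.
apply: (@polyfun_cancel _ _ _ (fun x => gap x b)).
- by apply: polyfunB; apply: polyfunM => //; apply: gP.
- exact: polyfun_gap.
- move=> x; have := h x; rewrite big_cons hq' -/(uc x b) -/(vc x b) -/(gap x b).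
  move=> hx; transitivity (gap x b * q' x * g c l x -
    gap x b * \prod_(j <- r) gap x j * N x); first by ring.
  by rewrite hx subrr.
- by rewrite /gap /uc mul0r subr0 oner_neq0.
Qed.

(** The entry of the next layer is polynomial up to factors 1 - u_s v_s,
    because it is an entry of the last layer at the image of the pentagram
    map; and it is polynomial up to an entry of an earlier layer, by the
    recurrence. *)
Lemma tau_next a j : (3 <= j.+1)%N -> (j.+2 <= K)%N -> exists f, polyfun f /\
  forall x, f x * g (a + 1) j.+1 x = g a j.+2 x * g (a + 1) j.+2 x -
    uc x a * vc x (a + j.+1%:Z) * (g (a - 1) j.+2 x * g (a + 2) j.+2 x).
Proof.
move=> j3 jK; have [s [p [pp hp]]] := polyfun_step (gP a jK).
have pN := polyfun_layer a jK.
have pq := polyfunM (polyfun_gaps a j.+2) pp.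
apply: (tau_strip (r := s) _ pq pN); first by rewrite j3; lia.
have pG : polyfun (g (a + 1) j.+1) by apply: gP; lia.
have pr := polyfun_prod s (fun a => polyfun_gap R a).
move=> x; apply/eqP; rewrite -subr_eq0; apply/eqP; move: x.
apply: good_dense => [|x gx].
  by apply: polyfunB; apply: polyfunM.
rewrite -hp // tau_step_rec // => [|c|c]; first by ring.
- by rewrite tau_step //; lia.
- by rewrite tau_step.
Qed.

(** The division by an entry of the second layer, 1 - u_(a+1) v_(a+1), by
    substitution of u_(a+1) v_(a+1) = 1 in the explicit third layer. *)
Lemma tau_next3 a : (3 <= K)%N -> exists f, polyfun f /\
  forall x, f x * g (a + 1) 2 x = g a 3 x * g (a + 1) 3 x -
    uc x a * vc x (a + 2) * (g (a - 1) 3 x * g (a + 2) 3 x).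
Proof.
move=> hK; have pN := polyfun_layer a hK.
have bb : 2 * (a + 1) != 2 * (a + 1) + 1 by lia.
have T3 c c0 c1 c2 x : c0 = c - 1 -> c1 = c + 1 -> c2 = c + 2 ->
    g c 3 x = gap x c * gap x c1 - uc x c * vc x c1 * (gap x c0 * gap x c2).
  by move=> -> -> ->; have := gR c x hK; rewrite !tau_gap ?g1 ?mulr1 //; lia.
have [x hx|f [pf hf]] := polyfun_div bb pN; last first.
  by exists f; split=> // x; rewrite hf tau_gap 1?mulrC //; lia.
have dx : gap x (a + 1) = 0 by rewrite /gap /uc /vc hx subrr.
rewrite (T3 a (a - 1) (a + 1) (a + 2)) // (T3 (a + 1) a (a + 2) (a + 3)); try lia.
rewrite (T3 (a - 1) (a - 2) a (a + 1)) ?(T3 (a + 2) (a + 1) (a + 3) (a + 4)); try lia.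
rewrite dx; have E : uc x (a + 1) * vc x (a + 1) = 1 by [].
transitivity (uc x a * vc x (a + 2) * gap x (a - 1) * gap x (a + 2) * gap x a *
  gap x (a + 3) * (uc x (a + 1) * vc x (a + 1) - 1)); last by rewrite E subrr mulr0.
ring.
Qed.

End TauSystem.

(** * Existence of its polynomial solution *)

Section TauExistence.
Variable R : numFieldType.
Implicit Types (g h : int -> nat -> (int -> R) -> R).

Lemma tau_systemW K L g : (L <= K)%N -> tau_system K g -> tau_system L g.
Proof.
by move=> LK [h1 h2 h3 h4]; split=> // *; [apply: h1|apply: h4]; lia.
Qed.

Lemma tau_system_unique K g h : tau_system K g -> tau_system K h ->
  forall l c x, (l <= K)%N -> g c l x = h c l x.
Proof.
move=> sg sh; have [pg g0 g1 gR] := sg; have [ph h0 h1 hR] := sh.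
elim/nat_ind2 => [c x _|c x _|l IH1 IH2 c x hl]; rewrite ?g0 ?h0 ?g1 ?h1 //.
apply/eqP; rewrite -subr_eq0; apply/eqP; move: x.
have lK : (l <= K)%N by lia.
apply: (tau_cancel sg (c := c + 1) lK) => [|x].
  by apply: polyfunB; [apply: pg|apply: ph].
rewrite mulrBl gR // [g (c + 1) l x]IH1 // hR // !IH2 ?subrr //; lia.
Qed.

Lemma tau_system_exists K : exists g, tau_system K g.
Proof.
elim: K => [|K [g sg]].
  by exists (fun _ _ _ => 1); split=> // *; apply: polyfun_cst.
have [pg g0 g1 gR] := sg.
case: K => [|K] in sg pg gR *.
  exists (fun c l x => if l is l'.+2 then 0 else g c l x); split=> //.
  move=> c [|[|l]] // _; first exact: pg.
  rewrite (_ : g c 1 = fun=> 1); first exact: polyfun_cst.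
  exact: funext.
have next a : exists f, polyfun f /\ forall x, f x * g (a + 1) K x =
    g a K.+1 x * g (a + 1) K.+1 x -
    uc x a * vc x (a + K%:Z) * (g (a - 1) K.+1 x * g (a + 2) K.+1 x).
  case: K => [|[|[|K]]] in sg pg gR *.
  - exists (fun x => g a 1 x * g (a + 1) 1 x -
      uc x a * vc x (a + 0%:Z) * (g (a - 1) 1 x * g (a + 2) 1 x)).
    by split=> [|x]; [apply: (polyfun_layer sg)|rewrite g0 mulr1].
  - exists (fun x => g a 2 x * g (a + 1) 2 x -
      uc x a * vc x (a + 1) * (g (a - 1) 2 x * g (a + 2) 2 x)).
    by split=> [|x]; [apply: (polyfun_layer sg)|rewrite g1 mulr1].
  - exact: (tau_next3 sg).
  - exact: (tau_next sg).
have /choice[f hf] := next.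
exists (fun c l => if l == K.+2 then f c else g c l); split.
- move=> c l hl; case: eqP => [_|h]; first by case: (hf c).
  by apply: pg; lia.
- by move=> c x /=; rewrite g0.
- by move=> c x /=; rewrite g1.
move=> a k x hk.
have -> : (k.+1 == K.+2) = false by lia.
have -> : (k == K.+2) = false by lia.
case: eqP => [[->]|h]; first by case: (hf a).
by apply: gR; lia.
Qed.

(** The recurrence defines an entry as a quotient, so that its polynomial
    solution is obtained by existence; it is unique by [tau_system_unique]. *)
Definition tau c l : (int -> R) -> R := sval (cid (tau_system_exists l)) c l.

Lemma tau_is_system K : tau_system K tau.
Proof.
have E l g c x : tau_system l g -> tau c l x = g c l x.
  by move=> sg; apply: (tau_system_unique (svalP (cid (tau_system_exists l))) sg).
have [g sg] := tau_system_exists K; have [pg g0 g1 gR] := sg.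
have F c l : (l <= K)%N -> tau c l = g c l.
  by move=> lK; apply: funext => x; apply: E; apply: tau_systemW sg.
split.
- by move=> c l lK; rewrite F //; apply: pg.
- by move=> c x; rewrite F.
- move=> c x; rewrite (E 1 (fun _ _ _ => 1)) //.
  by split=> // *; apply: polyfun_cst.
- by move=> a k x hk; rewrite !F; first exact: gR; lia.
Qed.

End TauExistence.
Arguments tau {R} c l x.

(** * Symmetries, and the coordinates of the iterates *)

Section TauTheory.
Variable R : numFieldType.
Implicit Types (x y : int -> R) (a b c e s h : int) (S : int -> bool).

Lemma polyfun_tau c l : polyfun (@tau R c l).
Proof. by case: (tau_is_system R l) => H _ _ _; apply: H. Qed.

Lemma tau0 c x : tau c 0 x = 1. Proof. by case: (tau_is_system R 0). Qed.
Lemma tau1 c x : tau c 1 x = 1. Proof. by case: (tau_is_system R 0). Qed.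
Lemma tau2 c x : tau c 2 x = gap x c. Proof. exact: (tau_gap (tau_is_system R 2)). Qed.

Lemma tauR a k x : tau a k.+2 x * tau (a + 1) k x =
        tau a k.+1 x * tau (a + 1) k.+1 x -
        uc x a * vc x (a + k%:Z) * (tau (a - 1) k.+1 x * tau (a + 2) k.+1 x).
Proof. by case: (tau_is_system R k.+2) => _ _ _; apply. Qed.

Lemma tau_unique (g : int -> nat -> (int -> R) -> R) :
  (forall K, tau_system K g) -> forall c l x, tau c l x = g c l x.
Proof. by move=> sg c l x; apply: (tau_system_unique (tau_is_system R l) (sg l)). Qed.

Definition shiftx h x : int -> R := fun J => x (J + 2 * h).

Lemma tau_shift h c l x : tau c l x = tau (c - h) l (shiftx h x).
Proof.
move: c l x; apply: tau_unique => K; split.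
- move=> c l _; apply: (polyfun_comp (h := shiftx h)); last exact: polyfun_tau.
  by move=> J; apply: polyfun_var.
- by move=> c x; rewrite tau0.
- by move=> c x; rewrite tau1.
move=> a k x _; rewrite (_ : a + 1 - h = a - h + 1); last by lia.
rewrite tauR; congr (_ - _ * (tau _ _ _ * tau _ _ _)); try by lia.
by rewrite /uc /vc /shiftx; congr (x _ * x _); lia.
Qed.

Definition reflx x : int -> R := fun J => x (- 1 - J).

Lemma uc_reflx x a : uc (reflx x) a = vc x (- 1 - a).
Proof. by rewrite /uc /vc /reflx; congr (x _); lia. Qed.

Lemma vc_reflx x a : vc (reflx x) a = uc x (- 1 - a).
Proof. by rewrite /uc /vc /reflx; congr (x _); lia. Qed.

Lemma reflxK x : reflx (reflx x) = x.
Proof. by apply: funext => J; rewrite /reflx; congr (x _); lia. Qed.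

(** Reversing the order of the vertices exchanges the u_a and the v_a. *)
Lemma tau_reflx c l x : tau c l x = tau (- c - l%:Z + 1) l (reflx x).
Proof.
move: c l x; apply: tau_unique => K; split.
- move=> c l _; apply: (polyfun_comp (h := reflx)); last exact: polyfun_tau.
  by move=> J; apply: polyfun_var.
- by move=> c x; rewrite tau0.
- by move=> c x; rewrite tau1.
move=> a k x _; pose A := - a - k%:Z - 1.
rewrite (_ : - a - k.+2%:Z + 1 = A); last by rewrite /A; lia.
rewrite (_ : - (a + 1) - k%:Z + 1 = A + 1); last by rewrite /A; lia.
rewrite tauR uc_reflx vc_reflx (_ : - 1 - A = a + k%:Z); last by rewrite /A; lia.
rewrite (_ : - 1 - (A + k%:Z) = a); last by rewrite /A; lia.
rewrite (_ : - a - k.+1%:Z + 1 = A + 1); last by rewrite /A; lia.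
rewrite (_ : - (a + 1) - k.+1%:Z + 1 = A); last by rewrite /A; lia.
rewrite (_ : - (a - 1) - k.+1%:Z + 1 = A + 2); last by rewrite /A; lia.
rewrite (_ : - (a + 2) - k.+1%:Z + 1 = A - 1); last by rewrite /A; lia.
ring.
Qed.

Definition tau_nonzero K x := forall c l, (l <= K)%N -> tau c l x != 0.

Lemma tau_nonzero_good K x : (2 <= K)%N -> tau_nonzero K x -> good x.
Proof. by move=> hK hx a; rewrite -tau2 hx. Qed.

Lemma tau_stepE c l x : good x -> tau c l.+1 x = gaps x c l * tau c l (step x).
Proof. by move=> gx; apply: (tau_step (tau_is_system R l.+1)). Qed.

Lemma tau_nonzero_step K x : (0 < K)%N -> tau_nonzero K.+1 x -> tau_nonzero K (step x).
Proof.
move=> K0 hx c l hl; have gx : good x by apply: tau_nonzero_good hx.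
have : tau c l.+1 x != 0 by apply: hx.
by rewrite tau_stepE // mulf_eq0 negb_or => /andP[].
Qed.

(** By induction, with the first step taken apart: by [tau_stepE] the entries at
    the image are entries of the next layer, up to factors which simplify with
    those of [uc_step] and [vc_step]. *)
Lemma iter_step_coords k x : tau_nonzero k.+1 x -> forall a,
  uc (iter k step x) a = uc x a * (tau (a - 1) k.+1 x * tau (a + 2) k x) /
    (tau (a + 1) k.+1 x * tau a k x) /\
  vc (iter k step x) a = vc x (a + k%:Z) * (tau (a + 2) k.+1 x * tau a k x) /
    (tau a k.+1 x * tau (a + 2) k x).
Proof.
elim: k x => [|k IH] x hx a.
  by rewrite /= !tau0 !tau1 !mulr1 addr0 invr1 !mulr1.
have gx : good x by apply: tau_nonzero_good hx.
have hsx : tau_nonzero k.+1 (step x) by apply: tau_nonzero_step.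
have n c l : (l <= k.+1)%N -> tau c l (step x) != 0 by apply: hsx.
have [Hu Hv] := IH _ hsx a.
have ts c l := tau_stepE c l gx.
rewrite iterSr Hu Hv uc_step vc_step !ts.
have gu := gaps_neq0 _ _ gx.
have d := gx.
rewrite (gaps_recl x (a - 1)) (gaps_recl x (a + 1) k) subrK.
rewrite (_ : a + 1 + 1 = a + 2); last by lia.
split.
  by field; rewrite !d !gu !n.
rewrite !gaps_recr (_ : a + k%:Z + 1 = a + k.+1%:Z); last by lia.
rewrite (_ : a + k%:Z + 2 = a + 2 + k%:Z); last by lia.
by field; rewrite !d !gu !n.
Qed.

End TauTheory.

(** * Zeros on the locus of an arithmetic progression *)

Section SingularLocus.
Variable R : numFieldType.
Implicit Types (x y : int -> R) (a b c e s : int) (S : int -> bool).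

Lemma sing_sub S S' x : (forall a, S' a -> S a) -> sing S x -> sing S' x.
Proof. by move=> h sx a /h; apply: sx. Qed.

Lemma sing_ones S : sing S (fun _ : int => 1 : R).
Proof. by move=> a _; rewrite /uc /vc mulr1. Qed.

Lemma nz_ones S (f : (int -> R) -> R) : f (fun=> 1) != 0 -> nonzero_on S f.
Proof. by move=> f1; exists (fun=> 1); split=> //; apply: sing_ones. Qed.

Lemma slope_ones c k : slope (fun _ : int => 1 : R) c k != 0.
Proof.
by apply: slope_neq0 => a *; rewrite ?/uc ?/vc oner_neq0.
Qed.

Lemma sing_updv S x e t : ~~ S e -> sing S x -> sing S (updv x e t).
Proof.
move=> Se sx a Sa; rewrite uc_updv vc_updv ifF ?sx //.
by apply: contraTF Sa => /eqP ->.
Qed.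

Lemma tau_affineE c k x t : tau c k.+2 (updv x (c + 2 * k%:Z) t) =
  tau c k.+2 x + (t - vc x (c + 2 * k%:Z)) * (slope x c k * tau (c - 1) k.+1 x).
Proof. exact: (tau_affine (tau_is_system R k.+2)). Qed.

Lemma tau_updv c l x e t : c + 2 * l%:Z - 4 < e -> tau c l (updv x e t) = tau c l x.
Proof. exact: (tau_updv_far (tau_is_system R l)). Qed.

(** When the variable of largest index is free, it suffices that its
    coefficient does not vanish identically. *)
Lemma nz_slope S c k : ~~ S (c + 2 * k%:Z) -> @nonzero_on R S (tau (c - 1) k.+1) ->
  @nonzero_on R S (tau c k.+2).
Proof.
move=> Se nt; have ns : @nonzero_on R S (fun x => slope x c k).
  by apply: nz_ones; apply: slope_ones.
have [x [sx hx]] := sing_irreducible (polyfun_slope R c k) (polyfun_tau R _ _) ns nt.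
case: (eqVneq (tau c k.+2 x) 0) => [h|h]; last by exists x.
exists (updv x (c + 2 * k%:Z) (vc x (c + 2 * k%:Z) + 1)); split.
  exact: sing_updv.
by rewrite tau_affineE h add0r addrC addKr mul1r.
Qed.

Definition prog s (m : nat) a := [&& s <= a, a < s + 2 * m%:Z & (2 %| a - s)%Z].

Lemma nz_tau_prog s m c l : s - 2 <= c < s -> @nonzero_on R (prog s m) (tau c l).
Proof.
move=> hc; apply: (@tau_nz R l tau (tau_is_system R l) (s - 2) (s - 1)); try lia.
- by move=> a ha; rewrite /prog; lia.
- by move=> j _; rewrite /prog; lia.
Qed.

(** The entries of the row of the first constrained index vanish: the row two
    steps further vanishes by induction, so that this row is proportional to
    the next one, with the factor 1 - u_s v_s. *)
Lemma tau_first_row m s k x : (0 < k <= m)%N -> sing (prog s m) x ->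
  tau s k.+1 x = 0.
Proof.
elim: m s k x => [|m IH] s k x hk sx; first by lia.
have s2 : sing (prog (s + 2) m) x by apply: sing_sub sx => a; rewrite /prog; lia.
suff H j : (0 < j <= m.+1)%N -> forall y, sing (prog (s + 2) m) y ->
    tau s j.+1 y = gap y s * tau (s + 1) j y.
  by rewrite H // /gap (sx s) ?subrr ?mul0r // /prog; lia.
elim: j => // j IHj hj y sy; case: j => [|j] in IHj hj *.
  by rewrite tau2 tau1 mulr1.
apply/eqP; rewrite -subr_eq0; apply/eqP; apply: contrapT => /eqP hy.
have n1 : nonzero_on (prog (s + 2) m)
    (fun x : int -> R => tau s j.+3 x - gap x s * tau (s + 1) j.+2 x) by exists y.
have n2 : @nonzero_on R (prog (s + 2) m) (tau (s + 1) j.+1).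
  by apply: nz_tau_prog; lia.
have p1 : polyfun (fun x : int -> R => tau s j.+3 x - gap x s * tau (s + 1) j.+2 x).
  apply: polyfunB; first exact: polyfun_tau.
  by apply: polyfunM; [apply: polyfun_gap|apply: polyfun_tau].
have [z [sz /negP []]] := sing_irreducible p1 (polyfun_tau R _ _) n1 n2.
rewrite mulrBl tauR IHj //; last by lia.
rewrite [tau (s + 2) _ z](IH (s + 2) j.+1) //.
by apply/eqP; ring.
Qed.

Lemma nz_prod (J : Type) (r : seq J) S (F : J -> (int -> R) -> R) :
  (forall j, polyfun (F j)) -> (forall j, nonzero_on S (F j)) ->
  nonzero_on S (fun x => \prod_(j <- r) F j x).
Proof.
move=> pF nF; elim: r => [|j r IH].
  by apply: nz_ones; rewrite big_nil oner_neq0.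
have [x hx] := sing_irreducible (pF j) (polyfun_prod r pF) (nF j) IH.
by exists x; rewrite big_cons.
Qed.

Lemma nz_weight S a b : @nonzero_on R S (fun x => uc x a * vc x b).
Proof. by apply: nz_ones; rewrite /uc /vc mulr1 oner_neq0. Qed.

Lemma polyfun_weight a b : polyfun (fun x : int -> R => uc x a * vc x b).
Proof. by apply: polyfunM; [apply: polyfun_uc|apply: polyfun_vc]. Qed.

(** The zeros of the last layer. With m - 1 constraints, the previous layer
    vanishes by induction, and the recurrence between the entries Q_a of the
    last layer becomes Q_a Q_(a+1) = u_a v_(a+m) Q_(a-1) Q_(a+2). Along a line
    on which the remaining variable v_e moves, the first two entries are
    constant and the third one is affine with its zero where the last
    constraint is satisfied; hence the order of vanishing at this point of the
    next entries is 1, 2, 2, 3, 3, ... *)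
Lemma tau_last_layer m s c x : s <= c < s + m%:Z -> sing (prog s m) x ->
  tau c m.+1 x = 0.
Proof.
case: m => [|m]; first by lia.
elim: m s c x => [|m IH] s c x hc sx.
  have -> : c = s by lia.
  exact: (@tau_first_row 1 s 1).
apply: contrapT => /eqP nx.
have bounds (i : nat) : (i <= m)%N -> s - 1 <= s - 1 + i%:Z < s + m.+1%:Z by lia.
have halves (i : nat) : (i.+1./2 + i.+2./2 = i./2 + i.+3./2)%N by rewrite /=; lia.
pose M := m.+2; pose e := s + 2 * m.+1%:Z.
pose F (i : nat) (y : int -> R) := uc y (s - 1 + i%:Z) * vc y (s - 1 + i%:Z + M%:Z).
have pF : polyfun (fun y : int -> R => \prod_(i <- iota 0 M) F i y).
  by apply: polyfun_prod => i; apply: polyfun_weight.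
have nF : nonzero_on (prog s M) (fun y : int -> R => \prod_(i <- iota 0 M) F i y).
  by apply: nz_prod => i; [apply: polyfun_weight|apply: nz_weight].
have pt := polyfun_tau R.
have n0 : @nonzero_on R (prog s M) (tau (s - 2) M.+1) by apply: nz_tau_prog; lia.
have n1 : @nonzero_on R (prog s M) (tau (s - 1) M.+1) by apply: nz_tau_prog; lia.
have n2 : @nonzero_on R (prog s M) (tau (s - 1) m.+2) by apply: nz_tau_prog; lia.
have n3 : @nonzero_on R (prog s M) (fun y => slope y s m.+1).
  by apply: nz_ones; apply: slope_ones.
have nc : @nonzero_on R (prog s M) (tau c M.+1) by exists x.
have pS := polyfun_slope R s m.+1.
have [z [sz]] := sing_irreducible
  (polyfunM pF (polyfunM (pt (s - 2) M.+1) (polyfunM (pt (s - 1) M.+1)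
    (polyfunM (pt (s - 1) m.+2) pS)))) (pt c M.+1)
  (sing_irreducible pF (polyfunM (pt (s - 2) M.+1) (polyfunM (pt (s - 1) M.+1)
    (polyfunM (pt (s - 1) m.+2) pS))) nF
   (sing_irreducible (pt (s - 2) M.+1) (polyfunM (pt (s - 1) M.+1)
     (polyfunM (pt (s - 1) m.+2) pS)) n0
    (sing_irreducible (pt (s - 1) M.+1) (polyfunM (pt (s - 1) m.+2) pS) n1
     (sing_irreducible (pt (s - 1) m.+2) pS n2 n3)))) nc.
set sl := slope z s m.+1.
rewrite mulf_eq0 negb_or => /andP[+ zc].
rewrite mulf_eq0 negb_or => /andP[zF].
rewrite mulf_eq0 negb_or => /andP[z0].
rewrite mulf_eq0 negb_or => /andP[z1].
rewrite mulf_eq0 negb_or => /andP[z2 z3].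
have {zF}zF a : s - 1 <= a < s + m.+1%:Z -> uc z a * vc z (a + M%:Z) != 0.
  move=> ha; move: zF; rewrite prodf_seq_neq0 => /allP /(_ (absz (a - (s - 1))%R)).
  rewrite mem_iota /F (_ : s - 1 + _ = a); last by lia.
  by apply; rewrite /M; lia.
pose t0 := vc z e; pose w t := updv z e t.
have w0 : w t0 = z by rewrite /w /updv /t0 /vc upd_id.
have sw t : sing (prog s m.+1) (w t).
  apply: sing_updv; first by rewrite /prog /e; lia.
  by apply: sing_sub sz => a; rewrite /prog /M; lia.
pose q (i : nat) t := tau (s - 2 + i%:Z) M.+1 (w t).
have rel (i : nat) t : (i <= m)%N -> q i.+1 t * q i.+2 t =
    uc z (s - 1 + i%:Z) * vc z (s - 1 + i%:Z + M%:Z) * (q i t * q i.+3 t).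
  move=> hi; have := tauR (s - 1 + i%:Z) M (w t).
  rewrite (IH s) ?mulr0 //; last by lia.
  move/eqP; rewrite eq_sym subr_eq0 => /eqP.
  rewrite /q /w uc_updv vc_updv ifF; last by apply/eqP; rewrite /e /M; lia.
  rewrite (_ : s - 2 + i.+1%:Z = s - 1 + i%:Z); last by lia.
  rewrite (_ : s - 2 + i.+2%:Z = s - 1 + i%:Z + 1); last by lia.
  rewrite (_ : s - 2 + i.+3%:Z = s - 1 + i%:Z + 2); last by lia.
  by rewrite (_ : s - 2 + i%:Z = s - 1 + i%:Z - 1); last by lia.
have q0 t : q 0%N t = tau (s - 2) M.+1 z.
  by rewrite /q addr0 /w tau_updv // /e /M; lia.
have q1 t : q 1%N t = tau (s - 1) M.+1 z.
  by rewrite /q (_ : s - 2 + 1 = s - 1) /w ?tau_updv // ?/e ?/M; lia.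
have q2 t : q 2 t = (sl * tau (s - 1) m.+2 z) * (t - t0).
  rewrite /q subrK /w /e tau_affineE -/sl (@tau_first_row M s m.+2) //; last first.
    by rewrite /M; lia.
  by rewrite add0r mulrC.
have H (i : nat) : (i <= M.+1)%N ->
    exists2 k, k != 0 & forall t, t != t0 -> q i t = k * (t - t0) ^+ i./2.
  elim/ltn_ind: i => i IHi hi; case: i => [|[|[|i]]] in IHi hi *.
  - by exists (tau (s - 2) M.+1 z) => // t _; rewrite q0 mulr1.
  - by exists (tau (s - 1) M.+1 z) => // t _; rewrite q1 mulr1.
  - exists (sl * tau (s - 1) m.+2 z); first by rewrite mulf_neq0.
    by move=> t _; rewrite q2.
  have iM : (i <= m)%N by move: hi; rewrite /M ltnS.
  have [||k0 nk0 h0] := IHi i; [by do 2 apply: leqW|by do 3 apply: leqW|].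
  have [||k1 nk1 h1] := IHi i.+1; [by apply: leqW|by do 2 apply: leqW|].
  have [||k2 nk2 h2] := IHi i.+2; [by []|by apply: leqW|].
  have wz : uc z (s - 1 + i%:Z) * vc z (s - 1 + i%:Z + M%:Z) != 0.
    by apply: zF; apply: bounds.
  exists (k1 * k2 / (uc z (s - 1 + i%:Z) * vc z (s - 1 + i%:Z + M%:Z) * k0)).
    by rewrite !mulf_neq0 ?invr_eq0 // mulf_neq0.
  move=> t tt0; have d0 : t - t0 != 0 by rewrite subr_eq0.
  have := rel i t iM; rewrite h0 // h1 // h2 //.
  have : (t - t0) ^+ i.+1./2 * (t - t0) ^+ i.+2./2 =
      (t - t0) ^+ i./2 * (t - t0) ^+ i.+3./2.
    by rewrite -!exprD halves.
  have := expf_neq0 i./2 d0.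
  move: ((t - t0) ^+ i./2) ((t - t0) ^+ i.+1./2) ((t - t0) ^+ i.+2./2)
    ((t - t0) ^+ i.+3./2) (q i.+3 t) wz => X0 X1 X2 X3 r.
  move: (uc z _ * vc z _) => W W0 nX0 EX E.
  have WkX : W * (k0 * X0) != 0 by rewrite !mulf_neq0.
  apply: (mulfI WkX); transitivity (k1 * k2 * (X1 * X2)).
    by transitivity (W * (k0 * X0 * r)); [ring|rewrite -E; ring].
  by rewrite EX; field; rewrite nk0 W0.
pose j := absz (c - s).
have [|k nk hk] := H j.+2; first by rewrite /j /M; lia.
have cj : s - 2 + j.+2%:Z = c by rewrite /j; lia.
move: zc; rewrite -w0 -cj -/(q j.+2 t0); apply/negP/negPn/eqP.
pose f t := q j.+2 t - k * (t - t0) ^+ (j.+2)./2.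
have pq : polynomial_map (q j.+2) by apply: polyfun_upd_poly; apply: pt.
have pd : polynomial_map (fun t => t - t0).
  by apply: polynomial_mapB; [apply: polynomial_map_id|apply: polynomial_map_cst].
have pf : polynomial_map f.
  apply: polynomial_mapB => //; apply: polynomial_mapM; first exact: polynomial_map_cst.
  have [p hp] := pd; exists (p ^+ (j.+2)./2) => t.
  by rewrite horner_exp hp.
have f0 := @polynomial_map_cancel _ f _ (t0 + 1) pf pd.
have /(_ t0) : forall t, f t = 0.
  apply: f0 => [t|]; last by rewrite addrC addKr oner_neq0.
  case: (eqVneq t t0) => [->|h]; first by rewrite subrr mulr0.
  by rewrite /f hk // subrr mul0r.
by rewrite /f subrr expr0n /= mulr0 subr0.
Qed.
End SingularLocus.

(** * Nonvanishing on the locus of a periodic progression *)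

Definition periodic_prog (n : nat) s m a := prog s m (s + ((a - s) %% n%:Z)%Z).

Section PeriodicLocus.
Variables (R : numFieldType) (n m : nat) (s : int).
Hypotheses (m_gt0 : (0 < m)%N) (n_large : (3 * m + 4 <= n)%N).
Implicit Types (x y : int -> R) (a b c e : int).

Lemma periodic_prog_prog s0 a : prog s0 m a -> periodic_prog n s0 m a.
Proof.
move=> h; rewrite /periodic_prog modz_small; first by rewrite addrC subrK.
by move: h; rewrite /prog; lia.
Qed.

Lemma periodic_prog_free s0 a (j : int) : s0 + 2 * m%:Z - 1 <= a + j * n%:Z < s0 + n%:Z ->
  ~~ periodic_prog n s0 m a.
Proof.
move=> h; rewrite /periodic_prog (_ : ((a - s0) %% n%:Z)%Z = a + j * n%:Z - s0); last first.
  rewrite -(@modz_small (a + j * n%:Z - s0) n%:Z); last by lia.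
  by rewrite (_ : a + j * n%:Z - s0 = j * n%:Z + (a - s0)) ?modzMDl //; lia.
by rewrite /prog; lia.
Qed.

Lemma periodic_prog_odd s0 a : s0 - 1 <= a < s0 + n%:Z -> (2 %| a - s0 + 1)%Z ->
  ~~ periodic_prog n s0 m a.
Proof.
move=> h d; case: (ltrP a s0) => h1; first by apply: (@periodic_prog_free _ _ 1); lia.
rewrite /periodic_prog modz_small; last by lia.
by rewrite /prog; lia.
Qed.

Lemma periodic_prog_period s0 a (j : int) :
  periodic_prog n s0 m (a + j * n%:Z) = periodic_prog n s0 m a.
Proof.
rewrite /periodic_prog; congr (prog _ _ (_ + _)).
by rewrite (_ : a + j * n%:Z - s0 = j * n%:Z + (a - s0)) ?modzMDl //; lia.
Qed.

Lemma periodic_prog_refl a :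
  periodic_prog n s m (- 1 - a) = periodic_prog n (1 - s - 2 * m%:Z) m a.
Proof.
rewrite /periodic_prog /prog.
have h1 := divz_eq (- 1 - a - s) n%:Z.
have h2 := divz_eq (a - (1 - s - 2 * m%:Z)) n%:Z.
have n0 : n%:Z != 0 by lia.
have := modz_ge0 (- 1 - a - s) n0; have := @ltz_mod (- 1 - a - s) n%:Z n0.
have := modz_ge0 (a - (1 - s - 2 * m%:Z)) n0.
have := @ltz_mod (a - (1 - s - 2 * m%:Z)) n%:Z n0.
move: h1 h2; set q := (_ %% _)%Z; set r := (_ %% _)%Z.
set d := (_ %/ _)%Z; set f := (_ %/ _)%Z => h1 h2 h3 h4 h5 h6.
have E : q + r = 2 * m%:Z - 2 - (d + f) * n%:Z by rewrite mulrDl; lia.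
have hn : `|n%:Z| = n%:Z by lia.
have [H|[H|H]] : d + f = 0 \/ d + f = -1 \/ (d + f <= -2 \/ 1 <= d + f) by lia.
- by rewrite H mul0r in E; lia.
- by rewrite H in E; lia.
- by nia.
Qed.

Local Notation S := (periodic_prog n s m).

(** Rows before the constrained indices: the u_a may be set to 0 up to s0 - 2,
    and the variables v_a used from then on have the indices s0 - 1, s0 + 1, ...
    of the other parity. *)
Lemma nz_tau_left s0 c l : (l <= m.+3)%N -> s0 + 2 * m%:Z - 1 - n%:Z <= c < s0 ->
  @nonzero_on R (periodic_prog n s0 m) (tau c l).
Proof.
move=> hl hc; apply: (@tau_nz R l tau (tau_is_system R l)
  (s0 + 2 * m%:Z - 1 - n%:Z) (s0 - 1)); try lia.
- by move=> a ha; apply: (@periodic_prog_free _ _ 1); lia.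
- by move=> j hj; apply: periodic_prog_odd; lia.
Qed.

Lemma nz_tau_right c l : (l <= m.+3)%N ->
  s + 2 * m%:Z < c + l%:Z <= s + n%:Z + 1 -> @nonzero_on R S (tau c l).
Proof.
move=> hl hc; have [|y [sy hy]] :=
  @nz_tau_left (1 - s - 2 * m%:Z) (- c - l%:Z + 1) l hl; first by lia.
exists (reflx y); split.
  move=> a Sa; rewrite uc_reflx vc_reflx mulrC; apply: sy.
  by rewrite -periodic_prog_refl (_ : - 1 - (- 1 - a) = a) //; lia.
by rewrite tau_reflx reflxK.
Qed.

Lemma sing_pprog x : sing S x -> sing (prog s m) x.
Proof. by apply: sing_sub => a; apply: periodic_prog_prog. Qed.

(** Next to the last vanishing layer the recurrence reduces to one between the
    entries of the layer, which propagates their nonvanishing. *)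
Lemma nz_tau_next c : s - 2 <= c <= s + m%:Z -> @nonzero_on R S (tau c m.+2).
Proof.
have main (i : nat) : (i <= m.+2)%N -> @nonzero_on R S (tau (s - 2 + i%:Z) m.+2).
  elim/ltn_ind: i => i IH; case: i => [|[|[|i]]] in IH *.
  - by move=> _; apply: nz_tau_left; lia.
  - by move=> _; apply: nz_tau_left; lia.
  - move=> _; rewrite subrK; apply: nz_slope; last by apply: nz_tau_left; lia.
    by apply: (@periodic_prog_free _ _ 0); lia.
  move=> hi.
  have n1 : @nonzero_on R S (tau (s - 2 + i.+1%:Z) m.+2) by apply: IH; lia.
  have n2 : @nonzero_on R S (tau (s - 2 + i.+2%:Z) m.+2) by apply: IH; lia.
  have [x [sx hx]] := sing_irreducible (polyfun_tau R _ _) (polyfun_tau R _ _) n1 n2.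
  exists x; split=> //; apply: contra_neq hx => hx.
  have := tauR (s - 1 + i%:Z) m.+1 x.
  rewrite (@tau_last_layer _ m s) ?mulr0; [|by lia|exact: sing_pprog].
  rewrite (_ : s - 1 + i%:Z + 2 = s - 2 + i.+3%:Z) ?hx ?mulr0 ?subr0; last by lia.
  move=> /esym; rewrite (_ : s - 2 + i.+1%:Z = s - 1 + i%:Z); last by lia.
  by rewrite (_ : s - 2 + i.+2%:Z = s - 1 + i%:Z + 1) //; lia.
move=> hc; have -> : c = s - 2 + (absz (c - (s - 2))%R)%:Z by lia.
by apply: main; lia.
Qed.

Lemma nz_tau_next2 c : s - 1 <= c <= s + m%:Z + 1 -> @nonzero_on R S (tau c m.+3).
Proof.
move=> hc; apply: nz_slope; last by apply: nz_tau_next; lia.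
by apply: (@periodic_prog_free _ _ 0); lia.
Qed.

(** One period of each of the two layers in the fractions of the iterate
    m + 2. *)
Lemma nz_tau_layers c l : (m.+2 <= l <= m.+3)%N ->
  s + 2 * m%:Z - 1 - n%:Z <= c < s + 2 * m%:Z - 1 -> @nonzero_on R S (tau c l).
Proof.
move=> hl hc; case: (ltrP c s) => h1; first by apply: nz_tau_left; lia.
case: (lerP c (s + m%:Z)) => h2; last by apply: nz_tau_right; lia.
have [->|->] : l = m.+2 \/ l = m.+3 by lia.
  by apply: nz_tau_next; lia.
by apply: nz_tau_next2; lia.
Qed.
End PeriodicLocus.

(** * Coordinates of a polygon as quotients of brackets *)

Section Brackets.
Variable R : realType.
Implicit Types (A : polygon R) (e : bool) (n : nat) (I J : int).
Implicit Types (p q r w : 'rV[R]_3).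

Definition bracket A I J (K : int) : R := triple (A I) (A J) (A K).

(** The brackets of four consecutive vertices, and the one which vanishes when
    the two diagonals through a vertex coincide. *)
Definition br_mid A J := bracket A (J - 2) J (J + 2).
Definition br_wide A J := bracket A (J - 4) J (J + 4).
Definition br_left A J := bracket A J (J + 2) (J + 6).
Definition br_right A J := bracket A J (J + 4) (J + 6).

Lemma triple_cyc p q r : triple p q r = triple q r p.
Proof. by rewrite /triple !dotE !crossE; ring. Qed.

Lemma triple_swap p q r : triple p q r = - triple q p r.
Proof. by rewrite /triple !dotE !crossE; ring. Qed.

Lemma triple_rev p q r : triple p q r = - triple r q p.
Proof. by rewrite /triple !dotE !crossE; ring. Qed.

Lemma triple_plucker p a b c d :
  triple a p c * triple b p d - triple p c d * triple a b p =
  triple a p d * triple b p c.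
Proof. by rewrite /triple !dotE !crossE; ring. Qed.

Lemma twistedP e n A : twisted e n A <->
  (forall J, has_parity e J ->
     [/\ br_mid A J != 0, br_left A J != 0 & br_right A J != 0]) /\
  exists2 phi : 'M[R]_3, phi \in unitmx &
    forall J, has_parity e J -> same_point (A J *m phi) (A (J + (2 * n)%:Z)).
Proof.
rewrite /twisted /=; split=> -[h1 h2]; split=> // J pJ.
  have pJ2 : has_parity e (J - 2) by move: pJ; rewrite /has_parity; lia.
  have [m1 _ _ _] := h1 _ pJ2; have [_ l r _] := h1 _ pJ.
  split; apply/eqP => //.
  by move: m1; rewrite subrK (_ : J - 2 + 4 = J + 2) //; lia.
have pJ2 : has_parity e (J + 2) by move: pJ; rewrite /has_parity; lia.
have pJ4 : has_parity e (J + 4) by move: pJ; rewrite /has_parity; lia.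
have [_ l r] := h1 _ pJ.
have [m2 _ _] := h1 _ pJ2; have [m4 _ _] := h1 _ pJ4.
rewrite /collinear /line_through -/(triple _ _ _).
split=> K; [case/eqP: m2|case/eqP: l|case/eqP: r|case/eqP: m4];
  rewrite -[RHS]K /br_mid /br_left /br_right /bracket;
  congr (triple (A _) (A _) (A _)); lia.
Qed.

Lemma xcoord_vertex e n A J : twisted e n A -> has_parity e J ->
  xcoord e A J = br_left A (J - 4) * br_mid A (J + 2) /
    (br_right A (J - 4) * br_right A (J - 2)).
Proof.
move=> tA pJ; rewrite (xcoord_tratio J tA) pJ /tratio.
rewrite [X in _ / (X * _)]triple_cyc [X in _ / (X * _)]triple_cyc.
rewrite [X in _ / (_ * X)]triple_cyc [X in _ / (_ * X)]triple_cyc.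
rewrite /br_left /br_mid /br_right /bracket.
by congr (triple (A _) (A _) (A _) * triple (A _) (A _) (A _) /
  (triple (A _) (A _) (A _) * triple (A _) (A _) (A _))); lia.
Qed.

Lemma xcoord_next e n A J : twisted e n A -> has_parity e J ->
  xcoord e A (J + 1) = br_right A (J - 2) * br_mid A (J - 2) /
    (br_left A (J - 2) * br_left A (J - 4)).
Proof.
move=> tA pJ; rewrite (xcoord_tratio (J + 1) tA) ifF /tratio; last first.
  by move: pJ; rewrite /has_parity; lia.
have -> : J + 1 + 3 = J + 4 by lia.
have -> : J + 1 + 1 = J + 2 by lia.
have -> : J + 1 - 1 = J by lia.
have -> : J + 1 - 3 = J - 2 by lia.
have -> : J + 1 - 5 = J - 4 by lia.
rewrite (triple_rev (A (J + 4))) (triple_rev (A J) (A (J - 2)) (A (J - 4))).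
rewrite (triple_swap (A J)) (triple_swap (A (J - 2)) (A (J - 4))) !mulrNN.
rewrite /br_left /br_mid /br_right /bracket.
by congr (triple (A _) (A _) (A _) * triple (A _) (A _) (A _) /
  (triple (A _) (A _) (A _) * triple (A _) (A _) (A _))); lia.
Qed.

(** The difference of two products of brackets is a product of brackets by a
    Pluecker relation. *)
Lemma xcoord_gap e n A J : twisted e n A -> has_parity e J ->
  1 - xcoord e A J * xcoord e A (J + 1) =
  br_wide A J * br_mid A J / (br_right A (J - 4) * br_left A (J - 2)).
Proof.
move=> tA pJ; rewrite (xcoord_vertex tA pJ) (xcoord_next tA pJ).
have [/(_ _ _) h _] := (twistedP e n A).1 tA.
have pJ2 : has_parity e (J - 2) by move: pJ; rewrite /has_parity; lia.
have pJ4 : has_parity e (J - 4) by move: pJ; rewrite /has_parity; lia.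
have [_ l2 r2] := h _ pJ2; have [_ l4 r4] := h _ pJ4.
have := triple_plucker (A J) (A (J - 4)) (A (J - 2)) (A (J + 2)) (A (J + 4)).
have -> : triple (A (J - 4)) (A J) (A (J + 2)) = br_right A (J - 4).
  by rewrite /br_right /bracket; congr (triple (A _) (A _) (A _)); lia.
have -> : triple (A (J - 2)) (A J) (A (J + 4)) = br_left A (J - 2).
  by rewrite /br_left /bracket; congr (triple (A _) (A _) (A _)); lia.
have -> : triple (A J) (A (J + 2)) (A (J + 4)) = br_mid A (J + 2).
  by rewrite /br_mid /bracket; congr (triple (A _) (A _) (A _)); lia.
have -> : triple (A (J - 4)) (A (J - 2)) (A J) = br_mid A (J - 2).
  by rewrite /br_mid /bracket; congr (triple (A _) (A _) (A _)); lia.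
rewrite -/(br_wide A J) -/(br_mid A J) => <-.
by field; rewrite l2 l4 r2 r4.
Qed.

Lemma xcoord_neq0 e n A J : twisted e n A -> xcoord e A J != 0.
Proof.
move=> tA; have [/(_ _ _) h _] := (twistedP e n A).1 tA.
case: (boolP (has_parity e J)) => pJ.
  have pJ2 : has_parity e (J - 2) by move: pJ; rewrite /has_parity; lia.
  have pJ4 : has_parity e (J - 4) by move: pJ; rewrite /has_parity; lia.
  have pJ' : has_parity e (J + 2) by move: pJ; rewrite /has_parity; lia.
  have [_ l2 r2] := h _ pJ2; have [_ l4 r4] := h _ pJ4; have [m _ _] := h _ pJ'.
  by rewrite (xcoord_vertex tA pJ) !mulf_neq0 ?invr_eq0 // mulf_neq0.
have pJ1 : has_parity e (J - 1) by move: pJ; rewrite /has_parity; lia.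
have pJ2 : has_parity e (J - 1 - 2) by move: pJ; rewrite /has_parity; lia.
have pJ4 : has_parity e (J - 1 - 4) by move: pJ; rewrite /has_parity; lia.
have [m l2 r2] := h _ pJ2; have [_ l4 r4] := h _ pJ4.
by rewrite -[J](subrK 1) (xcoord_next tA pJ1) !mulf_neq0 ?invr_eq0 // mulf_neq0.
Qed.

Lemma xcoord_period e n A J : twisted e n A ->
  xcoord e A (J + (2 * n)%:Z) = xcoord e A J.
Proof.
move=> tA; have [_ [phi uphi h]] := tA.
have pE : has_parity e (J + (2 * n)%:Z) = has_parity e J.
  by rewrite /has_parity; lia.
have shift K : has_parity e K -> forall L, L = K + (2 * n)%:Z ->
  same_point (A K *m phi) (A L) by move=> pK L ->; apply: h.
rewrite !(xcoord_tratio _ tA) pE; symmetry.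
case: ifP => pJ; apply: (tratio_equiv uphi); apply: shift; try lia;
  by move: pJ; rewrite /has_parity; lia.
Qed.

End Brackets.

(** * Brackets of the image under the pentagram map *)

Section PentagramGeometry.
Variable R : realType.
Implicit Types (A : polygon R) (e : bool) (n : nat) (I J : int).
Implicit Types (p q r w : 'rV[R]_3).

Definition diagonal A J := cross (A (J - 2)) (A (J + 2)).

Lemma pentagramE A J I : I = J + 1 ->
  pentagram A I = cross (diagonal A J) (diagonal A (J + 2)).
Proof.
move=> ->; rewrite /pentagram /meet_lines /line_through /diagonal.
by congr (cross (cross (A _) (A _)) (cross (A _) (A _))); lia.
Qed.

Lemma triple_meets l1 l2 l3 w : triple (cross l1 l2) (cross l2 l3) w =
  triple l1 l2 l3 * dot l2 w.
Proof. by rewrite /triple !dotE !crossE; ring. Qed.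

Lemma diagonals_mid A J : triple (diagonal A (J - 2)) (diagonal A J) (diagonal A (J + 2)) =
  br_mid A J * br_wide A J.
Proof.
rewrite /diagonal triple_cyc.
have -> : A (J + 2 - 2) = A J by congr (A _); lia.
have -> : A (J - 2 + 2) = A J by congr (A _); lia.
have -> : A (J - 2 - 2) = A (J - 4) by congr (A _); lia.
have -> : A (J + 2 + 2) = A (J + 4) by congr (A _); lia.
rewrite /br_mid /br_wide /bracket.
by rewrite /triple !dotE !crossE; ring.
Qed.

Lemma diagonals_left A J : triple (diagonal A J) (diagonal A (J + 4)) (diagonal A (J + 6)) =
  br_left A (J + 2) * br_wide A (J + 2).
Proof.
rewrite /diagonal triple_cyc triple_cyc.
have -> : A (J + 4 - 2) = A (J + 2) by congr (A _); lia.
rewrite triple_lines triple_cyc /br_left /br_wide /bracket; congr (_ * _).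
  by rewrite triple_cyc; congr (triple (A _) (A _) (A _)); lia.
by congr (triple (A _) (A _) (A _)); lia.
Qed.

Lemma diagonals_right A J : triple (diagonal A J) (diagonal A (J - 6)) (diagonal A (J - 4)) =
  br_right A (J - 8) * br_wide A (J - 2).
Proof.
rewrite /diagonal triple_cyc.
have -> : A (J - 4 + 2) = A (J - 2) by congr (A _); lia.
rewrite triple_lines /br_right /br_wide /bracket; congr (_ * _).
  by congr (triple (A _) (A _) (A _)); lia.
by congr (triple (A _) (A _) (A _)); lia.
Qed.

Let t A J := br_mid A J * br_wide A J.

(** Two adjacent vertices of the image are on a common diagonal, so that their
    line is this diagonal, up to a product of two brackets. *)
Lemma pentagram_adjacent A J I K w : I = J - 1 -> K = J + 1 ->
  triple (pentagram A I) (pentagram A K) w = t A J * dot (diagonal A J) w.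
Proof.
move=> hI hK; rewrite (@pentagramE A (J - 2)) ?(@pentagramE A J) //; last by lia.
by rewrite subrK triple_meets diagonals_mid.
Qed.

Lemma dot_diagonal A J L I : I = L + 1 -> dot (diagonal A J) (pentagram A I) =
  triple (diagonal A J) (diagonal A L) (diagonal A (L + 2)).
Proof. by move=> hI; rewrite (pentagramE A hI) dotC -/(triple _ _ _) -triple_cyc. Qed.

Lemma br_mid_pentagram A J : br_mid (pentagram A) (J + 1) = t A J * t A (J + 2).
Proof.
rewrite /br_mid /bracket (@pentagram_adjacent A J) //; last by lia.
rewrite (@dot_diagonal A J (J + 2)); last by lia.
rewrite /t -(diagonals_mid A (J + 2)) addrK.
by congr (_ * triple (diagonal A _) (diagonal A _) (diagonal A _)); lia.
Qed.

Lemma br_left_pentagram A J : br_left (pentagram A) (J - 1) =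
  t A J * (br_left A (J + 2) * br_wide A (J + 2)).
Proof.
rewrite /br_left /bracket (@pentagram_adjacent A J) //; last by lia.
rewrite (@dot_diagonal A J (J + 4)); last by lia.
have := diagonals_left A J; rewrite /br_left /bracket => <-.
by congr (_ * triple (diagonal A _) (diagonal A _) (diagonal A _)); lia.
Qed.

Lemma br_right_pentagram A J : br_right (pentagram A) (J - 5) =
  t A J * (br_right A (J - 8) * br_wide A (J - 2)).
Proof.
rewrite {1}/br_right /bracket triple_cyc (@pentagram_adjacent A J); try lia.
rewrite (@dot_diagonal A J (J - 6)); last by lia.
by rewrite -diagonals_right; congr (_ * triple _ _ (diagonal A _)); lia.
Qed.

Lemma cross_cross p q r w :
  cross (cross p q) (cross r w) = triple p q w *: r - triple p q r *: w.
Proof. by apply: row3P; rewrite /triple !Defs.rowE !dotE !crossE; ring. Qed.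

Lemma same_point_pentagram A I K (M : 'M[R]_3) : M \in unitmx ->
  (forall L, same_point (A (I + L) *m M) (A (K + L)) \/ ~~ odd `|L|%N) ->
  same_point (pentagram A I *m M) (pentagram A K).
Proof.
move=> uM h; rewrite /pentagram /meet_lines /line_through.
have [[a na ->]|//] := h (- 3); have [[b nb ->]|//] := h 1.
have [[c nc ->]|//] := h (- 1); have [[d nd ->]|//] := h 3.
exists (a * b * c * d * mxtriple M); first by rewrite !mulf_neq0 // mxtriple_neq0.
rewrite !cross_cross !tripleZ !tripleM mulmxBl -!scalemxAl scalerBr !scalerA.
by congr (_ *: _ - _ *: _); ring.
Qed.

Section Step.
Variables (e : bool) (n : nat) (A : polygon R) (off : int).
Hypotheses (tA : twisted e n A) (poff : has_parity e off).

Definition coords e A off : int -> R := fun J => xcoord e A (J + off).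

Local Notation y := (coords e A off).
Hypothesis gy : good y.

Let vertex a := 2 * a + off.

Let vertex_parity a : has_parity e (vertex a).
Proof. by move: poff; rewrite /has_parity /vertex; lia. Qed.

Let gapE a : gap y a = br_wide A (vertex a) * br_mid A (vertex a) /
  (br_right A (vertex (a - 2)) * br_left A (vertex (a - 1))).
Proof.
have := xcoord_gap tA (vertex_parity a).
rewrite (_ : vertex a - 4 = vertex (a - 2)); last by rewrite /vertex; lia.
rewrite (_ : vertex a - 2 = vertex (a - 1)); last by rewrite /vertex; lia.
move=> <-; rewrite /gap /uc /vc /coords; congr (1 - _ * xcoord e A _).
by rewrite /vertex; lia.
Qed.

Let nz0 a : [/\ br_mid A (vertex a) != 0, br_left A (vertex a) != 0 &
  br_right A (vertex a) != 0].
Proof. by have [h _] := (twistedP e n A).1 tA; apply: h. Qed.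

Let nzw a : br_wide A (vertex a) != 0.
Proof.
have := gy a; rewrite gapE; apply: contra_neq => ->.
by rewrite !mul0r.
Qed.

Let nzt a : t A (vertex a) != 0.
Proof. by rewrite /t mulf_neq0 //; case: (nz0 a). Qed.

Let Bl b c : c = vertex b - 1 -> br_left (pentagram A) c =
  t A (vertex b) * (br_left A (vertex (b + 1)) * br_wide A (vertex (b + 1))).
Proof.
move=> ->; rewrite br_left_pentagram.
by congr (_ * (br_left A _ * br_wide A _)); rewrite /vertex; lia.
Qed.

Let Br b c : c = vertex b - 5 -> br_right (pentagram A) c =
  t A (vertex b) * (br_right A (vertex (b - 4)) * br_wide A (vertex (b - 1))).
Proof.
move=> ->; rewrite br_right_pentagram.
by congr (_ * (br_right A _ * br_wide A _)); rewrite /vertex; lia.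
Qed.

Let Bm b c : c = vertex b + 1 -> br_mid (pentagram A) c =
  t A (vertex b) * t A (vertex (b + 1)).
Proof.
by move=> ->; rewrite br_mid_pentagram; congr (_ * t A _); rewrite /vertex; lia.
Qed.

Lemma pentagram_twisted : twisted (~~ e) n (pentagram A).
Proof.
apply/twistedP; split.
  move=> J pJ; have [a hJ] : exists a, J = vertex a + 1.
    exists ((J - 1 - off) %/ 2)%Z.
    by move: poff pJ; rewrite /has_parity /vertex; lia.
  rewrite (Bm hJ) (@Bl (a + 1)) ?(@Br (a + 3)); try by rewrite hJ /vertex; lia.
  split.
  - exact: (mulf_neq0 (nzt a) (nzt (a + 1))).
  - have [_ l _] := nz0 (a + 1 + 1).
    exact: (mulf_neq0 (nzt (a + 1)) (mulf_neq0 l (nzw (a + 1 + 1)))).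
  - have [_ _ r] := nz0 (a + 3 - 4).
    exact: (mulf_neq0 (nzt (a + 3)) (mulf_neq0 r (nzw (a + 3 - 1)))).
have [_ [phi uphi h]] := tA.
exists phi => // J pJ; apply: same_point_pentagram => // L.
case: (boolP (odd `|L|%N)) => oL; [left|by right].
rewrite (_ : J + (2 * n)%:Z + L = J + L + (2 * n)%:Z); last by lia.
by apply: h; move: pJ; rewrite /has_parity; lia.
Qed.

(** Both sides are quotients of the same brackets, those of the image being
    products of brackets of the polygon. *)
Lemma coords_pentagram : coords (~~ e) (pentagram A) (off + 1) = step y.
Proof.
have E a : uc (coords (~~ e) (pentagram A) (off + 1)) a = uc (step y) a /\
           vc (coords (~~ e) (pentagram A) (off + 1)) a = vc (step y) a.
  have [s1 s2 s3] : [/\ 2 * a + 1 + off = vertex a + 1,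
    2 * a + (off + 1) = vertex a + 1 & 2 * a + 1 + (off + 1) = vertex a + 1 + 1].
    by split; rewrite /vertex; lia.
  have pJ : has_parity (~~ e) (vertex a + 1).
    by have := vertex_parity a; rewrite /has_parity; lia.
  rewrite uc_step vc_step !gapE.
  have Vu b : uc y b = br_left A (vertex (b - 2)) * br_mid A (vertex (b + 1)) /
      (br_right A (vertex (b - 2)) * br_right A (vertex (b - 1))).
    rewrite /uc /coords (xcoord_vertex tA (vertex_parity b)).
    by congr (br_left A _ * br_mid A _ / (br_right A _ * br_right A _));
      rewrite /vertex; lia.
  have Vv b : vc y b = br_right A (vertex (b - 1)) * br_mid A (vertex (b - 1)) /
      (br_left A (vertex (b - 1)) * br_left A (vertex (b - 2))).
    rewrite /vc /coords (_ : 2 * b + 1 + off = vertex b + 1); last by rewrite /vertex; lia.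
    rewrite (xcoord_next tA (vertex_parity b)).
    by congr (br_right A _ * br_mid A _ / (br_left A _ * br_left A _));
      rewrite /vertex; lia.
  have i1 : a - 1 + 1 = a by lia.
  have i2 : a + 1 + 1 = a + 2 by lia.
  have i3 : a + 1 - 4 = a - 3 by lia.
  have i4 : a + 1 - 1 = a by lia.
  have i5 : a + 2 - 4 = a - 2 by lia.
  have i6 : a + 2 - 1 = a + 1 by lia.
  have i7 : a - 1 - 2 = a - 3 by lia.
  have i8 : a - 1 - 1 = a - 2 by lia.
  have i9 : a + 1 - 2 = a - 1 by lia.
  have i10 : a + 2 - 2 = a by lia.
  split.
    have -> : uc (coords (~~ e) (pentagram A) (off + 1)) a =
      xcoord (~~ e) (pentagram A) (vertex a + 1) by rewrite /uc /coords s2.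
    rewrite (xcoord_vertex pentagram_twisted pJ) Vu.
    rewrite (@Bl (a - 1) (vertex a + 1 - 4)) ?(@Bm (a + 1))
      ?(@Br (a + 1) (vertex a + 1 - 4)) ?(@Br (a + 2) (vertex a + 1 - 2));
      try by rewrite /vertex; lia.
    rewrite i1 i2 i3 i4 i5 i6 i7 i8 i9 /t.
    have [m1 l1 r1] := nz0 (a + 1); have [m2 l2 r2] := nz0 (a + 2).
    have [m3 l3 r3] := nz0 (a - 1); have [m4 l4 r4] := nz0 (a - 2).
    have [m5 l5 r5] := nz0 (a - 3); have [m6 l6 r6] := nz0 a.
    by field; rewrite ?(m1, m2, m3, m4, m5, m6) ?(l1, l2, l3, l4, l5, l6)
      ?(r1, r2, r3, r4, r5, r6) ?nzw.
  have -> : vc (coords (~~ e) (pentagram A) (off + 1)) a =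
    xcoord (~~ e) (pentagram A) (vertex a + 1 + 1) by rewrite /vc /coords s3.
  rewrite (xcoord_next pentagram_twisted pJ) Vv.
  rewrite (@Bl a (vertex a + 1 - 2)) ?(@Bl (a - 1) (vertex a + 1 - 4))
    ?(@Bm (a - 1)) ?(@Br (a + 2)); try by rewrite /vertex; lia.
  rewrite i1 i5 i6 i10 i4 i9 /t.
  have [m1 l1 r1] := nz0 (a + 1); have [m2 l2 r2] := nz0 (a + 2).
  have [m3 l3 r3] := nz0 (a - 1); have [m4 l4 r4] := nz0 (a - 2).
  have [m6 l6 r6] := nz0 a.
  by field; rewrite ?(m1, m2, m3, m4, m6) ?(l1, l2, l3, l4, l6)
    ?(r1, r2, r3, r4, r6) ?nzw.
apply: funext => J; case: (boolP (2 %| J)%Z) => dJ.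
  have [+ _] := E (J %/ 2)%Z; rewrite /uc (_ : 2 * (J %/ 2)%Z = J) //; lia.
have [_] := E (J %/ 2)%Z; rewrite /vc (_ : 2 * (J %/ 2)%Z + 1 = J) //; lia.
Qed.
End Step.

End PentagramGeometry.

(** * Polygons with prescribed coordinates *)

Section PolygonWithCoordinates.
Variable R : realType.
Implicit Types (e : bool) (n : nat) (J k : int).
Implicit Types (p q r w : 'rV[R]_3).

Lemma int_orbit (T : Type) (f g : int -> T -> T) (s0 : T) :
  (forall k s, f k (g k s) = s) ->
  exists W : int -> T, W 0 = s0 /\ forall k, W (k + 1) = f k (W k).
Proof.
move=> fgK.
pose fwd := fix F (i : nat) := if i is i'.+1 then f i'%:Z (F i') else s0.
pose bwd := fix B (i : nat) := if i is i'.+1 then g (- i%:Z) (B i') else s0.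
exists (fun k => match k with Posz i => fwd i | Negz i => bwd i.+1 end).
split=> // -[i|i]; first by rewrite (_ : Posz i + 1 = Posz i.+1) //; lia.
case: i => [|i]; first by rewrite (_ : Negz 0 + 1 = 0) /= ?fgK //; lia.
by rewrite (_ : Negz i.+1 + 1 = Negz i) /= ?NegzE ?fgK //; lia.
Qed.

Lemma int_ind_succ (P : int -> Prop) : P 0 -> (forall k, P k -> P (k + 1)) ->
  (forall k, P (k + 1) -> P k) -> forall k, P k.
Proof.
move=> h0 hp hm; elim=> [|i IH|i IH] //.
  by rewrite (_ : i.+1%:Z = i%:Z + 1); [apply: hp|lia].
by apply: hm; rewrite (_ : - i.+1%:Z + 1 = - i%:Z) //; lia.
Qed.

Lemma mxtriple_unit (M : 'M[R]_3) : mxtriple M != 0 -> M \in unitmx.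
Proof.
move=> hM; rewrite -row_free_unit; apply: inj_row_free => u uM.
have T v w : triple u v w = 0.
  apply: (mulIf hM); rewrite mul0r -tripleM uM.
  by rewrite /triple dotE !crossE !mxE; ring.
have := T (delta_mx 0 1) (delta_mx 0 2%:R); have := T (delta_mx 0 2%:R) (delta_mx 0 0).
have := T (delta_mx 0 0) (delta_mx 0 1).
rewrite /triple !dotE !crossE !mxE /= !(mulr0, mulr1, subr0, add0r, sub0r, addr0) => h1 h2 h3.
apply: row3P; rewrite [RHS]mxE.
- by move: h3; rewrite ?oppr0 ?mul0r ?addr0 ?add0r.
- by move: h2; rewrite ?oppr0 ?mul0r ?addr0 ?add0r.
- by move: h1; rewrite ?oppr0 ?mul0r ?addr0 ?add0r.
Qed.

Lemma triple_succ (b c : R) p q r :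
  triple q r (r + b *: q + c *: p) = c * triple p q r.
Proof. by rewrite /triple !dotE !crossE !Defs.rowE; ring. Qed.

Lemma triple_left (b c : R) p q r : triple p q (r + b *: q + c *: p) = triple p q r.
Proof. by rewrite /triple !dotE !crossE !Defs.rowE; ring. Qed.

Lemma triple_right (b c : R) p q r :
  triple p r (r + b *: q + c *: p) = - b * triple p q r.
Proof. by rewrite /triple !dotE !crossE !Defs.rowE; ring. Qed.

(** Up to scaling of the vertices, the linear relation between four consecutive
    ones may be given two coefficients equal to 1. Its two other coefficients are
    then monomials in the coordinates; hence they determine a polygon, which is
    twisted when they are periodic. *)
Lemma polygon_exists e n (x : int -> R) : (forall J, x J != 0) ->
  (forall J, x (J + (2 * n)%:Z) = x J) ->
  exists A : polygon R, twisted e n A /\ forall J, xcoord e A J = x J.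
Proof.
move=> x0 xn; pose off : int := (e : nat)%:Z.
pose v k := 2 * k + off.
pose b k := - x (v k + 3).
pose c k := x (v k + 2) * x (v k + 1) * x (v k + 3).
have b0 k : b k != 0 by rewrite oppr_eq0.
have c0 k : c k != 0 by rewrite !mulf_neq0.
pose T := ('rV[R]_3 * 'rV[R]_3 * 'rV[R]_3)%type.
pose f k (s : T) : T := let: (p, q, r) := s in (q, r, r + b k *: q + c k *: p).
pose g k (s : T) : T := let: (q, r, w) := s in ((c k)^-1 *: (w - r - b k *: q), q, r).
have fgK k s : f k (g k s) = s.
  case: s => [[q r] w]; rewrite /f /g; congr (_, _, _).
  rewrite scalerA divff // scale1r; apply: row3P; rewrite !Defs.rowE; ring.
have [W [W0 W1]] := int_orbit (delta_mx 0 0, delta_mx 0 1, delta_mx 0 2%:R) fgK.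
pose a k := (W k).1.1.
have aW k : W k = (a k, a (k + 1), a (k + 2)).
  have -> : k + 2 = k + 1 + 1 by lia.
  by rewrite /a !W1 /f; case: (W k) => [[p q] r].
have rec k : a (k + 3) = a (k + 2) + b k *: a (k + 1) + c k *: a k.
  have := congr1 (fun s : T => s.2) (W1 k); rewrite (aW k) (aW (k + 1)) /f /=.
  by have -> : k + 1 + 2 = k + 3 by lia.
pose d k := triple (a k) (a (k + 1)) (a (k + 2)).
have dS k : d (k + 1) = c k * d k.
  rewrite /d; have -> : k + 1 + 2 = k + 3 by lia.
  have -> : k + 1 + 1 = k + 2 by lia.
  by rewrite rec; apply: triple_succ.
have d0 k : d k != 0.
  elim/int_ind_succ: k => [|k dk|k].
  - have : W 0 = (a 0, a (0 + 1), a (0 + 2)) by rewrite aW.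
    rewrite W0 /d => -[<- <- <-].
    rewrite /triple !dotE !crossE !mxE /=.
    by rewrite !(mulr0, mul0r, mulr1, subr0, addr0, add0r) oner_neq0.
  - by rewrite dS mulf_neq0.
  - by rewrite dS mulf_eq0 negb_or => /andP[].
pose A : polygon R := fun I => a ((I - off) %/ 2)%Z.
have Av I k : I = v k -> A I = a k.
  by move=> ->; rewrite /A /v; congr (a _); lia.
have mid k I : I = v k + 2 -> br_mid A I = d k.
  move=> ->; rewrite /br_mid /bracket (Av (v k + 2 - 2) k)
    ?(Av (v k + 2) (k + 1)) ?(Av (v k + 2 + 2) (k + 2)) //; by rewrite /v; lia.
have left k I : I = v k -> br_left A I = d k.
  move=> ->; rewrite /br_left /bracket (Av (v k) k) ?(Av (v k + 2) (k + 1))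
    ?(Av (v k + 6) (k + 3)) //; try by rewrite /v; lia.
  by rewrite rec triple_left.
have right k I : I = v k -> br_right A I = - b k * d k.
  move=> ->; rewrite /br_right /bracket (Av (v k) k) ?(Av (v k + 4) (k + 2))
    ?(Av (v k + 6) (k + 3)) //; try by rewrite /v; lia.
  by rewrite rec triple_right.
have par I : has_parity e I -> exists k, I = v k.
  move=> pI; exists ((I - off) %/ 2)%Z; move: pI; rewrite /has_parity /v /off.
  by case: (e) => /=; lia.
have pv k : has_parity e (v k).
  by rewrite /has_parity /v /off; case: (e) => /=; lia.
have bn k : b (k + n%:Z) = b k.
  by rewrite /b -[in RHS]xn; congr (- x _); rewrite /v; lia.
have cn k : c (k + n%:Z) = c k.
  by rewrite /c -[in RHS](xn (v k + 1)) -[in RHS](xn (v k + 2)) -[in RHS](xn (v k + 3));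
    congr (x _ * x _ * x _); rewrite /v; lia.
pose phi := \matrix_(i < 3) a (n%:Z + (i : nat)%:Z).
have uphi : phi \in unitmx.
  apply: mxtriple_unit; rewrite /mxtriple !rowK /= addr0.
  by rewrite -/(d n%:Z).
have per k : a (k + n%:Z) = a k *m phi.
  have recn j : a (j + n%:Z + 3) = a (j + n%:Z + 2) + b j *: a (j + n%:Z + 1) +
      c j *: a (j + n%:Z) by rewrite rec bn cn.
  have recp j : a (j + 3) *m phi = a (j + 2) *m phi + b j *: (a (j + 1) *m phi) +
      c j *: (a j *m phi) by rewrite rec !mulmxDl -!scalemxAl.
  suff : [/\ a (k + n%:Z) = a k *m phi, a (k + n%:Z + 1) = a (k + 1) *m phi &
    a (k + n%:Z + 2) = a (k + 2) *m phi] by case.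
  elim/int_ind_succ: k => [|k [h0 h1 h2]|k [h1 h2 h3]].
  - have : W 0 = (a 0, a (0 + 1), a (0 + 2)) by rewrite aW.
    rewrite W0 => -[<- <- <-]; rewrite -!rowE !rowK /= add0r addr0; split=> //.
  - rewrite (_ : k + 1 + n%:Z = k + n%:Z + 1); last by lia.
    rewrite (_ : k + n%:Z + 1 + 1 = k + n%:Z + 2); last by lia.
    rewrite (_ : k + n%:Z + 1 + 2 = k + n%:Z + 3); last by lia.
    have -> : k + 1 + 1 = k + 2 by lia.
    have -> : k + 1 + 2 = k + 3 by lia.
    by split=> //; rewrite recn recp h0 h1 h2.
  - move: h1 h2 h3.
    rewrite (_ : k + 1 + n%:Z = k + n%:Z + 1); last by lia.
    rewrite (_ : k + n%:Z + 1 + 1 = k + n%:Z + 2); last by lia.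
    rewrite (_ : k + n%:Z + 1 + 2 = k + n%:Z + 3); last by lia.
    have -> : k + 1 + 1 = k + 2 by lia.
    have -> : k + 1 + 2 = k + 3 by lia.
    move=> h1 h2 h3; split=> //.
    have := recn k; rewrite h1 h2 h3 recp => /addrI /(scalerI (c0 k)).
    by move=> ->.
have tA : twisted e n A.
  apply/twistedP; split=> [J /par[k hk]|].
    rewrite (left k) // (right k) // (mid (k - 1)); last by rewrite hk /v; lia.
    by split=> //; rewrite mulf_neq0 ?oppr_eq0.
  exists phi => // J /par[k hk]; exists 1; first exact: oner_neq0.
  rewrite scale1r (Av J k) // (Av _ (k + n%:Z)) ?per //.
  by rewrite hk /v; lia.
exists A; split=> // J; case: (boolP (has_parity e J)) => pJ.
  have [k hk] := par _ pJ; rewrite (xcoord_vertex tA pJ).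
  rewrite (left (k - 2)) ?(mid k) ?(right (k - 2) (J - 4))
    ?(right (k - 1) (J - 2)); try by rewrite hk /v; lia.
  have := dS (k - 1); rewrite subrK => ->.
  have E1 : b (k - 2) = - x (v k - 1) by rewrite /b; congr (- x _); rewrite /v; lia.
  have E2 : b (k - 1) = - x (v k + 1) by rewrite /b; congr (- x _); rewrite /v; lia.
  have E3 : c (k - 1) = x (v k) * x (v k - 1) * x (v k + 1).
    by rewrite /c; congr (x _ * x _ * x _); rewrite /v; lia.
  by rewrite E1 E2 E3 hk; field; rewrite !x0 !d0.
have [|k hk] := par (J - 1); first by move: pJ; rewrite /has_parity; lia.
rewrite (_ : J = v k + 1); last by rewrite -hk subrK.
rewrite (xcoord_next tA (pv k)).
rewrite (left (k - 1) (v k - 2)) ?(left (k - 2) (v k - 4)) ?(mid (k - 2))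
  ?(right (k - 1)); try by rewrite /v; lia.
have E2 : b (k - 1) = - x (v k + 1) by rewrite /b; congr (- x _); rewrite /v; lia.
by rewrite E2; field; rewrite !d0.
Qed.

End PolygonWithCoordinates.

(** * Fractions for the coordinates of the iterates *)

Section PolynomialsAsFunctions.
Variables (R : numFieldType) (N : nat).
Implicit Types (z : 'I_N -> R).

Lemma polyfun_mpoly (f : ('I_N -> R) -> R) : polyfun f ->
  exists p : {mpoly R[N]}, forall z, p.@[z] = f z.
Proof.
elim=> [c|i|f1 f2 _ [p1 h1] _ [p2 h2]|f1 f2 _ [p1 h1] _ [p2 h2]].
- by exists (c%:MP) => z; rewrite mevalC.
- by exists 'X_i => z; rewrite mevalXU.
- by exists (p1 + p2) => z; rewrite mevalD h1 h2.
- by exists (p1 * p2) => z; rewrite mevalM h1 h2.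
Qed.

Lemma meval_polyfun (p : {mpoly R[N]}) : polyfun (fun z => p.@[z]).
Proof.
pose F m z := p@_m * \prod_i z i ^+ m i.
have pF m : polyfun (F m).
  apply: polyfunM; first exact: polyfun_cst.
  by apply: polyfun_prod => i; apply: polyfunX; apply: polyfun_var.
rewrite (_ : (fun _ => _) = fun z => \sum_(m <- msupp p) F m z); last first.
  by apply: funext => z; rewrite mevalE.
elim: (msupp p : seq _) => [|m s IH].
  rewrite (_ : (fun _ => _) = fun=> 0); first exact: polyfun_cst.
  by apply: funext => z; rewrite big_nil.
rewrite (_ : (fun _ => _) = fun z => F m z + \sum_(m <- s) F m z).
  exact: polyfunD.
by apply: funext => z; rewrite big_cons.
Qed.
End PolynomialsAsFunctions.

Section Fractions.
Variable R : numFieldType.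
Implicit Types (J a : int) (k : nat).

(** The two halves of [iter_step_coords], with the pair of formulas read as one
    fraction at each index. *)
Definition numer k J (x : int -> R) : R := let a := (J %/ 2)%Z in
  if (2 %| J)%Z then uc x a * (tau (a - 1) k.+1 x * tau (a + 2) k x)
  else vc x (a + k%:Z) * (tau (a + 2) k.+1 x * tau a k x).

Definition denom k J (x : int -> R) : R := let a := (J %/ 2)%Z in
  if (2 %| J)%Z then tau (a + 1) k.+1 x * tau a k x
  else tau a k.+1 x * tau (a + 2) k x.

Lemma polyfun_numer k J : polyfun (numer k J).
Proof.
rewrite /numer; case: (2 %| J)%Z; apply: polyfunM; try exact: polyfun_uc;
  try exact: polyfun_vc; by apply: polyfunM; apply: polyfun_tau.
Qed.

Lemma polyfun_denom k J : polyfun (denom k J).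
Proof. by rewrite /denom; case: (2 %| J)%Z; apply: polyfunM; apply: polyfun_tau. Qed.

Lemma iter_stepE k J x : tau_nonzero k.+1 x ->
  iter k step x J = numer k J x / denom k J x.
Proof.
move=> hx; have [hu hv] := iter_step_coords hx (J %/ 2)%Z.
rewrite /numer /denom; case: (boolP (2 %| J)%Z) => dJ.
  by rewrite -hu /uc; congr (iter _ _ _ _); lia.
by rewrite -hv /vc; congr (iter _ _ _ _); lia.
Qed.
End Fractions.

(** * Periodic sequences *)

Section PeriodicSequences.
Variables (R : numFieldType) (n : nat).
Hypothesis n_gt0 : (0 < n)%N.
Implicit Types (z : 'I_(2 * n) -> R) (J K a c : int) (S : int -> bool).

Let idx_lt J : (`|((J - 1)%R %% (2 * n)%:Z)%Z| < 2 * n)%N.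
Proof.
have n0 : (2 * n)%:Z != 0 by lia.
by have := modz_ge0 (J - 1) n0; have := ltz_mod (J - 1) n0; lia.
Qed.

(** The ordinal j stands for the coordinate x_(j+1), as in [xvec]. *)
Definition idx J : 'I_(2 * n) := Ordinal (idx_lt J).

Definition ext z : int -> R := fun J => z (idx J).

Lemma idxE J : exists t : int, (nat_of_ord (idx J))%:Z = J - 1 - t * (2 * n)%:Z.
Proof.
have n0 : (2 * n)%:Z != 0 by lia.
exists ((J - 1) %/ (2 * n)%:Z)%Z; rewrite /idx /=.
have := divz_eq (J - 1) (2 * n)%:Z; have := modz_ge0 (J - 1) n0; lia.
Qed.

Lemma idx_eq J (j : 'I_(2 * n)) (t : int) :
  J = (j : nat)%:Z + 1 + t * (2 * n)%:Z -> idx J = j.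
Proof.
move=> ->; apply: val_inj => /=.
rewrite (_ : _ + 1 + _ - 1 = t * (2 * n)%:Z + (j : nat)%:Z); last by lia.
by rewrite modzMDl modz_small //; have := ltn_ord j; lia.
Qed.

Lemma idx_ord (j : 'I_(2 * n)) : idx (j.+1%:Z) = j.
Proof. by apply: (@idx_eq _ _ 0); lia. Qed.

Lemma idx_period J t : idx (J + t * (2 * n)%:Z) = idx J.
Proof.
have [r hr] := idxE J; apply: (@idx_eq _ _ (t + r)).
by rewrite hr mulrDl; lia.
Qed.

Lemma ext_period z J t : ext z (J + t * (2 * n)%:Z) = ext z J.
Proof. by rewrite /ext idx_period. Qed.

Lemma polyfun_ext (f : (int -> R) -> R) : polyfun f -> polyfun (fun z => f (ext z)).
Proof. by apply: polyfun_comp => J; apply: polyfun_var. Qed.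

Definition nonzero_on_ext S (f : ('I_(2 * n) -> R) -> R) :=
  exists z, sing S (ext z) /\ f z != 0.

Definition periodic S := forall a t, S (a + t * n%:Z) = S a.

Lemma nzp_irreducible S f g : periodic S -> polyfun f -> polyfun g ->
  nonzero_on_ext S f -> nonzero_on_ext S g -> nonzero_on_ext S (fun z => f z * g z).
Proof.
move=> perS pf pg [z1 [s1 f1]] [z2 [s2 g2]].
pose P (j : 'I_(2 * n)) := odd j && S ((j.+1)./2%:Z).
have oS (j : 'I_(2 * n)) : odd j -> ~~ odd (ordS j).
  move=> oj; rewrite /ordS /=; case: (ltnP j.+1 (2 * n)) => h.
    by rewrite modn_small //= oj.
  by rewrite (_ : j.+1 = (2 * n)%N) ?modnn //; have := ltn_ord j; lia.
have E z : sing S (ext z) <-> paired P (@ordS _) z.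
  have sI J : ordS (idx J) = idx (J + 1).
    have [t ht] := idxE J; have lj := ltn_ord (idx J).
    have v : nat_of_ord (ordS (idx J)) = ((idx J).+1 %% (2 * n))%N by [].
    symmetry; case: (ltnP (idx J).+1 (2 * n)) => h.
      by apply: (@idx_eq _ _ t); rewrite v modn_small //; lia.
    apply: (@idx_eq _ _ (t + 1)); rewrite v (_ : (idx J).+1 = (2 * n)%N); last by lia.
    by rewrite modnn mulrDl; lia.
  split=> h.
    move=> j /andP[oj Sj]; have := h _ Sj; rewrite /uc /vc /ext.
    have e1 : 2 * (j.+1)./2%:Z = j.+1%:Z :> int by lia.
    by rewrite e1 -sI !idx_ord.
  move=> a Sa; have [t ht] := idxE (2 * a).
  have oj : odd (idx (2 * a)) by lia.
  have := h (idx (2 * a)); rewrite /P oj /uc /vc /ext -sI; apply.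
  by rewrite -[_%:Z](_ : a + - t * n%:Z = _) ?perS //; lia.
have Pt j : P j -> ~~ P (ordS j).
  by move=> /andP[oj _]; rewrite /P negb_and oS.
have [||z [sz fgz]] := paired_irreducible (@ordSK _) (@ord_predK _) Pt pf pg.
- by exists z1; split=> //; apply/E.
- by exists z2; split=> //; apply/E.
- by exists z; split=> //; apply/E.
Qed.

Lemma sing_ext_ones S : sing S (ext (fun=> 1)).
Proof. by move=> a _; rewrite /uc /vc /ext mulr1. Qed.

Lemma nzp_ones S f : f (fun=> 1) != 0 -> nonzero_on_ext S f.
Proof. by exists (fun=> 1); split=> //; apply: sing_ext_ones. Qed.

Lemma nzp_prod (T : eqType) (r : seq T) S (F : T -> ('I_(2 * n) -> R) -> R) :
  periodic S -> (forall i, polyfun (F i)) -> {in r, forall i, nonzero_on_ext S (F i)} ->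
  nonzero_on_ext S (fun z => \prod_(i <- r) F i z).
Proof.
move=> perS pF; elim: r => [|i r IH] nF.
  by apply: nzp_ones; rewrite big_nil oner_neq0.
have nr : {in r, forall j, nonzero_on_ext S (F j)}.
  by move=> j jr; apply: nF; rewrite inE jr orbT.
have [z hz] := nzp_irreducible perS (pF i) (polyfun_prod r pF)
  (nF i (mem_head i r)) (IH nr).
by exists z; rewrite big_cons.
Qed.

(** The window on which an entry depends is not longer than a period, so that a
    point of the locus agrees on it with a periodic one. *)
Lemma nzp_tau S c k : periodic S -> (3 * k <= n + 2)%N ->
  @nonzero_on R S (tau c k.+1) -> nonzero_on_ext S (fun z => tau c k.+1 (ext z)).
Proof.
move=> perS kn [x [sx hx]]; pose lo := c - k%:Z + 1.
have n0 : n%:Z != 0 by lia.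
have n20 : (2 * n)%:Z != 0 by lia.
pose blk J := 2 * lo + ((J - 2 * lo) %% (2 * n)%:Z)%Z.
pose z (j : 'I_(2 * n)) := x (blk j.+1%:Z).
have extz J : ext z J = x (blk J).
  have [t ht] := idxE J; rewrite /ext /z /blk; congr (x (_ + _)).
  rewrite (_ : (idx J).+1%:Z - 2 * lo = - t * (2 * n)%:Z + (J - 2 * lo)).
    by rewrite modzMDl.
  by rewrite mulNr; lia.
exists z; split.
  move=> a Sa; pose q := ((a - lo) %/ n%:Z)%Z; pose b := a + - q * n%:Z.
  have hb : lo <= b < lo + n%:Z.
    have := divz_eq (a - lo) n%:Z; have := modz_ge0 (a - lo) n0.
    have := ltz_mod (a - lo) n0; rewrite -/q /b mulNr; lia.
  have := sx b; rewrite /b perS => /(_ Sa) => <-; rewrite -/b.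
  have B (r : int) : 0 <= r <= 1 -> blk (2 * a + r) = 2 * b + r.
    move=> hr; rewrite /blk.
    rewrite (_ : 2 * a + r - 2 * lo = q * (2 * n)%:Z + (2 * b + r - 2 * lo)).
      by rewrite modzMDl modz_small; lia.
    by rewrite /b mulNr PoszM mulrCA; lia.
  have := B 0 isT; rewrite !addr0 => B0.
  by rewrite /uc /vc !extz B0 B.
suff -> : tau c k.+1 (ext z) = tau c k.+1 x by [].
apply: (tau_local (tau_is_system R k.+1)) => // a ha.
have B (r : int) : 0 <= r <= 1 -> blk (2 * a + r) = 2 * a + r.
  by move=> hr; rewrite /blk modz_small; rewrite /lo; lia.
have := B 0 isT; rewrite !addr0 => B0.
by rewrite /uc /vc !extz B0 B.
Qed.

Lemma tau_ext_period z c l t : tau (c + t * n%:Z) l (ext z) = tau c l (ext z).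
Proof.
rewrite (tau_shift (t * n%:Z)) addrK; congr (tau _ _ _); apply: funext => J.
by rewrite /shiftx -(ext_period z J t); congr (ext _ _); lia.
Qed.

Lemma numer_period k J t z :
  numer k (J + t * (2 * n)%:Z) (ext z) = numer k J (ext z).
Proof.
rewrite /numer.
have -> : (2 %| J + t * (2 * n)%:Z)%Z = (2 %| J)%Z.
  by rewrite PoszM mulrCA; lia.
have -> : ((J + t * (2 * n)%:Z) %/ 2)%Z = (J %/ 2)%Z + t * n%:Z.
  by rewrite PoszM mulrCA; lia.
have U a b : a = b + t * n%:Z -> uc (ext z) a = uc (ext z) b.
  by move=> ->; rewrite /uc -(ext_period z (2 * b) t); congr (ext _ _); lia.
have V a b : a = b + t * n%:Z -> vc (ext z) a = vc (ext z) b.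
  by move=> ->; rewrite /vc -(ext_period z (2 * b + 1) t); congr (ext _ _); lia.
have T a b l : a = b + t * n%:Z -> tau a l (ext z) = tau b l (ext z).
  by move=> ->; apply: tau_ext_period.
by case: ifP => _; congr (_ * (_ * _)); [apply: U|apply: T|apply: T|apply: V
  |apply: T|apply: T]; lia.
Qed.

Lemma denom_period k J t z :
  denom k (J + t * (2 * n)%:Z) (ext z) = denom k J (ext z).
Proof.
rewrite /denom.
have -> : (2 %| J + t * (2 * n)%:Z)%Z = (2 %| J)%Z.
  by rewrite PoszM mulrCA; lia.
have -> : ((J + t * (2 * n)%:Z) %/ 2)%Z = (J %/ 2)%Z + t * n%:Z.
  by rewrite PoszM mulrCA; lia.
have T a b l : a = b + t * n%:Z -> tau a l (ext z) = tau b l (ext z).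
  by move=> ->; apply: tau_ext_period.
by case: ifP => _; congr (_ * _); apply: T; lia.
Qed.

End PeriodicSequences.

(** * The iterates as rational maps *)

Local Open Scope classical_set_scope.

Section Iterates.
Variables (R : realType) (n : nat).
Hypothesis n_gt0 : (0 < n)%N.
Implicit Types (A B C : polygon R) (e : bool) (k : nat) (J a c : int).
Implicit Types (z : 'I_(2 * n) -> R) (S : int -> bool).

Local Notation ext := (ext n_gt0).

(** The good behaviour of all polygons up to the k-th iterate is that of the
    sequence of coordinates of the first one. *)
Lemma pentagram_iter k e A off : twisted e n A -> has_parity e off ->
  tau_nonzero k.+1 (coords e A off) -> forall l, (l <= k)%N ->
  twisted (odd l (+) e) n (iter l (@pentagram R) A) /\
  coords (odd l (+) e) (iter l (@pentagram R) A) (off + l%:Z) =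
    iter l step (coords e A off).
Proof.
elim: k e A off => [|k IH] e A off tA po hx [|l] hl //; rewrite ?addr0 //.
have gy : good (coords e A off) by apply: tau_nonzero_good hx.
have tB := pentagram_twisted tA po gy; have cB := coords_pentagram tA po gy.
have po1 : has_parity (~~ e) (off + 1) by move: po; rewrite /has_parity; lia.
have hs : tau_nonzero k.+1 (coords (~~ e) (pentagram A) (off + 1)).
  by rewrite cB; apply: tau_nonzero_step.
have [h1 h2] := IH _ _ _ tB po1 hs l hl.
rewrite !iterSr -cB /= addNb -addbN; split=> //.
by rewrite -h2; congr (coords _ _ _); lia.
Qed.

Lemma coords_ext e A : twisted e n A -> coords e A 0 = ext (@xvec R e n A).
Proof.
move=> tA; apply: funext => J; rewrite /coords addr0 /ext /xvec.
have [t ht] := idxE n_gt0 J.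
have P : forall r : int, xcoord e A (J + r * (2 * n)%:Z) = xcoord e A J.
  elim/int_ind_succ => [|r IH|r IH]; first by rewrite mul0r addr0.
    by rewrite mulrDl mul1r addrA (xcoord_period _ tA).
  by rewrite -IH mulrDl mul1r addrA (xcoord_period _ tA).
by rewrite -(P (- t)); congr (xcoord _ _ _); rewrite mulNr; lia.
Qed.

Lemma polygon_of_ext e z : (forall j, z j != 0) ->
  exists A : polygon R, twisted e n A /\ @xvec R e n A = z.
Proof.
move=> z0; have [J|J|A [tA hA]] := @polygon_exists R e n (ext z).
- exact: z0.
- by have := ext_period n_gt0 z J 1; rewrite mul1r.
exists A; split=> //; apply: funext => j.
by rewrite /xvec hA /ext idx_ord.
Qed.

Lemma iterate_coords k C : twisted false n C ->
  tau_nonzero k.+1 (ext (@xvec R false n C)) ->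
  pentagram_defined false n k C /\ forall j,
    @xvec R (odd k (+) false) n (iter k (@pentagram R) C) j =
    numer k (j.+1%:Z - k%:Z) (ext (@xvec R false n C)) /
    denom k (j.+1%:Z - k%:Z) (ext (@xvec R false n C)).
Proof.
move=> tC; rewrite -coords_ext // => hx.
have H := @pentagram_iter k false C 0 tC isT hx.
split=> [l hl|j]; first by case: (H l hl).
have [_] := H k (leqnn k) => E.
rewrite -iter_stepE // -E /xvec /coords; congr (xcoord _ _ _); lia.
Qed.

(** By periodicity, a nonzero value of this polynomial makes all entries up to
    the layer k + 1 nonzero, and the k-th iterate defined. *)
Definition tau_product k z := \prod_(c <- iota 0 n) \prod_(l <- iota 0 k.+2)
  tau c%:Z l (ext z).

Lemma polyfun_tau_product k : polyfun (tau_product k).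
Proof.
do 2 apply: polyfun_prod => ?.
by apply: (polyfun_ext n_gt0); apply: polyfun_tau.
Qed.

Lemma tau_productP k z : tau_product k z != 0 -> tau_nonzero k.+1 (ext z).
Proof.
rewrite /tau_product prodf_seq_neq0 => /allP h c l hl.
have n0 : n%:Z != 0 by lia.
have := divz_eq c n%:Z; have := modz_ge0 c n0; have := ltz_mod c n0.
set q := (c %/ _)%Z; set r := (c %% _)%Z => h1 h2 h3.
have {h} := h (absz r); rewrite mem_iota prodf_seq_neq0 => /(_ _)/allP H.
have /H/(_ l) : (0 <= `|r|%N < 0 + n)%N by lia.
rewrite mem_iota (_ : (absz r)%:Z = r) /=; last by lia.
have -> : c = r + q * n%:Z by lia.
rewrite tau_ext_period; apply; lia.
Qed.

Lemma nzp_tau_product k : nonzero_on_ext n_gt0 pred0 (tau_product k).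
Proof.
exists (fun=> 0); split=> //; rewrite /tau_product prodf_seq_neq0.
apply/allP => c _; rewrite /= prodf_seq_neq0; apply/allP => l _ /=.
by rewrite /ext (tau_at0 (tau_is_system R l)) // oner_neq0.
Qed.

Lemma periodic0 : periodic n pred0. Proof. by []. Qed.

(** Genericity in a subvariety given by equations u_a v_a = 1 follows from its
    irreducibility. *)
Lemma generically_intro S (X Q : set (polygon R)) (f : ('I_(2 * n) -> R) -> R) :
  periodic n S ->
  (forall A, X A <-> twisted false n A /\ sing S (ext (@xvec R false n A))) ->
  polyfun f -> nonzero_on_ext n_gt0 S f ->
  (forall A, X A -> f (@xvec R false n A) != 0 -> Q A) -> generically false n X Q.
Proof.
move=> perS XE pf nf hQ; have [p hp] := polyfun_mpoly pf.
exists [set A | twisted false n A /\ exists2 f, [set p] f & f.@[ @xvec R false n A] != 0].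
split=> [|V [F ->] [A [/XE[tA sA] [_ [g Fg gA]]]]|A XA [tA [_ ->]]].
- by exists [set p].
- have pg := meval_polyfun g.
  have pc : polyfun (fun z => \prod_j z j).
    by apply: polyfun_prod => j; apply: polyfun_var.
  have nc : nonzero_on_ext n_gt0 S (fun z => \prod_j z j).
    by apply: nzp_ones; rewrite big1 ?oner_neq0.
  (* The factor \prod_j z j makes the point found the coordinates of a
     polygon. *)
  have ng : nonzero_on_ext n_gt0 S (fun z => g.@[z]) by exists (@xvec R false n A).
  have [z [sz]] := nzp_irreducible perS (polyfunM pf pg) pc
    (nzp_irreducible perS pf pg nf ng) nc.
  rewrite mulf_eq0 negb_or mulf_eq0 negb_or => /andP[/andP[fz gz]].
  rewrite prodf_seq_neq0 => /allP cz.
  have [|C [tC xC]] := @polygon_of_ext false z.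
    by move=> j; apply: cz; rewrite mem_index_enum.
  exists C; split; [by apply/XE; rewrite xC|split=> //|split=> //].
    by exists g => //; rewrite xC.
  by exists p => //; rewrite xC hp.
- by rewrite hp; apply: hQ.
Qed.

Lemma iterate_fractions_exists k : exists p q : 'I_(2 * n) -> {mpoly R[2 * n]},
  [/\ @iterate_fractions R false n k p q,
    forall j z, (p j).@[z] = numer k (j.+1%:Z - k%:Z) (ext z) &
    forall j z, (q j).@[z] = denom k (j.+1%:Z - k%:Z) (ext z)].
Proof.
have /choice[p hp] : forall j : 'I_(2 * n), exists p : {mpoly R[2 * n]},
    forall z, p.@[z] = numer k (j.+1%:Z - k%:Z) (ext z).
  by move=> j; apply: polyfun_mpoly; apply: (polyfun_ext n_gt0); apply: polyfun_numer.
have /choice[q hq] : forall j : 'I_(2 * n), exists p : {mpoly R[2 * n]},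
    forall z, p.@[z] = denom k (j.+1%:Z - k%:Z) (ext z).
  by move=> j; apply: polyfun_mpoly; apply: (polyfun_ext n_gt0); apply: polyfun_denom.
exists p, q; split=> //.
apply: (generically_intro periodic0 _ (polyfun_tau_product k) (nzp_tau_product k)).
  by move=> A; split=> [tA|[]].
move=> A tA /tau_productP hx; have [h1 h2] := iterate_coords tA hx.
split=> // j; rewrite /ratfun_at hp hq; split; last by [].
by rewrite /denom; case: ifP => _; rewrite mulf_neq0 // hx.
Qed.

(** Both systems compute the same coordinates at a common point of any nonempty
    open set, in particular of the one where the two products would differ. *)
Lemma iterate_fractions_unique k p q p' q' :
  @iterate_fractions R false n k p q -> iterate_fractions false k p' q' ->
  forall j z, (p j).@[z] * (q' j).@[z] = (p' j).@[z] * (q j).@[z].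
Proof.
move=> [U [[F ->] dU hU]] [U' [oU' dU' hU']] j z.
apply/eqP; rewrite -subr_eq0; apply: contrapT => /negP neq.
pose f := p j * q' j - p' j * q j.
have fE y : f.@[y] = (p j).@[y] * (q' j).@[y] - (p' j).@[y] * (q j).@[y].
  by rewrite mevalB !mevalM.
have V0 h : (exists y, h.@[y] != 0) ->
    exists A, twisted false n A /\ h.@[ @xvec R false n A] != 0 :> R.
  move=> nh; have pc : polyfun (fun z : 'I_(2 * n) -> R => \prod_j z j).
    by apply: polyfun_prod => i; apply: polyfun_var.
  have nc : nonzero_on_ext n_gt0 pred0 (fun z : 'I_(2 * n) -> R => \prod_j z j).
    by apply: nzp_ones; rewrite big1 ?oner_neq0.
  have nh' : nonzero_on_ext n_gt0 pred0 (fun z => h.@[z]) by case: nh => y hy; exists y.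
  have [y [_]] := nzp_irreducible periodic0 (meval_polyfun h) pc nh' nc.
  rewrite mulf_eq0 negb_or prodf_seq_neq0 => /andP[hy /allP cy].
  have [|C [tC xC]] := @polygon_of_ext false y.
    by move=> i; apply: cy; rewrite mem_index_enum.
  by exists C; rewrite xC.
have op h : zariski_open false n
    [set A | twisted false n A /\ exists2 f, [set h] f & f.@[ @xvec R false n A] != 0 :> R].
  by exists [set h].
have [|A [tA fA]] := V0 f; first by exists z; rewrite fE.
have [|A1 [tA1 [_ [_ -> fA1]] [_ [g Fg gA1]]]] := dU _ (op f).
  by exists A; split=> //; split=> //; exists f.
have fgA1 : (f * g).@[ @xvec R false n A1] != 0 by rewrite mevalM mulf_neq0.
have [|A2 [tA2 [_ [_ -> fg2]] UA2]] := dU' _ (op (f * g)).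
  by exists A1; split=> //; split=> //; exists (f * g).
move: fg2; rewrite mevalM mulf_eq0 negb_or => /andP[f2 g2].
have [_ h] := hU A2 tA2 (conj tA2 (ex_intro2 _ _ g Fg g2)).
have [_ h'] := hU' A2 tA2 UA2.
have [q0 E] := h j; have [q0' E'] := h' j.
move: f2; rewrite fE; apply/negP; rewrite negbK subr_eq0.
have := E; rewrite E' => /eqP; rewrite eqr_div //.
by rewrite eq_sym.
Qed.

End Iterates.

(** * Singular and regular iterates on the locus *)

Section Locus.
Variables (R : realType) (n m : nat) (s : int).
Hypotheses (n_gt0 : (0 < n)%N) (m_gt0 : (0 < m)%N) (n_large : (3 * m + 4 <= n)%N).
Implicit Types (A B : polygon R) (J a c : int).

Local Notation ext := (ext n_gt0).
Local Notation S := (periodic_prog n s m).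

Let perS : periodic n S. Proof. by move=> a t; apply: periodic_prog_period. Qed.

(** If the iterate were regular at A, then each of its coordinates, which are
    nonzero, would be a quotient P / Q of polynomials which are nonzero at A,
    hence at generic points of the locus. By [iterate_fractions_unique] its
    numerator and denominator from [numer] and [denom] would vanish at the same
    generic points. But for a suitable coordinate exactly one of the entries in
    them vanishes on the locus. *)
Lemma singular_iterate k A : (1 <= k <= m + 1)%N -> twisted false n A ->
  sing S (ext (@xvec R false n A)) -> ~ @regular_at R false n k A.
Proof.
move=> hk tA sA [B [_ tB [p [q [fr pq]]]]].
have [p' [q' [fr' hp' hq']]] := @iterate_fractions_exists R n n_gt0 k.
have main (a : int) (f : ('I_(2 * n) -> R) -> R) :
    polyfun f -> nonzero_on_ext n_gt0 S f ->
    exists2 z, sing S (ext z) & f z != 0 /\ exists P Q : R, [/\ P != 0, Q != 0 &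
      P * denom k (2 * a) (ext z) = numer k (2 * a) (ext z) * Q].
  move=> pf nf; pose j := idx n_gt0 (2 * a + k%:Z).
  have [q0 hB] := pq j.
  have p0 : (p j).@[ @xvec R false n A] != 0.
    have : @xvec R (odd k (+) false) n B j != 0 by apply: (xcoord_neq0 _ tB).
    by rewrite hB mulf_eq0 negb_or => /andP[].
  have np : nonzero_on_ext n_gt0 S (fun z => (p j).@[z]) by exists (@xvec R false n A).
  have nq : nonzero_on_ext n_gt0 S (fun z => (q j).@[z]) by exists (@xvec R false n A).
  have [z [sz]] := nzp_irreducible perS pf
    (polyfunM (meval_polyfun (p j)) (meval_polyfun (q j))) nf
    (nzp_irreducible perS (meval_polyfun (p j)) (meval_polyfun (q j)) np nq).
  rewrite mulf_eq0 negb_or => /andP[fz]; rewrite mulf_eq0 negb_or => /andP[pz qz].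
  exists z => //; split=> //; exists (p j).@[z], (q j).@[z]; split=> //.
  have := iterate_fractions_unique n_gt0 fr fr' j z; rewrite hp' hq'.
  have [t ht] := idxE n_gt0 (2 * a + k%:Z).
  have -> : j.+1%:Z - k%:Z = 2 * a + - t * (2 * n)%:Z by rewrite mulNr /j; lia.
  by rewrite numer_period denom_period.
have sp z : sing S (ext z) -> sing (prog s m) (ext z) by apply: sing_pprog.
have N c l : (l <= m + 1)%N -> s - 4 <= c < s ->
    nonzero_on_ext n_gt0 S (fun z : 'I_(2 * n) -> R => tau c l.+1 (ext z)).
  move=> hl hc; apply: nzp_tau => //; first by lia.
  by apply: nz_tau_left; lia.
have NE a k' x : (numer k' (2 * a) x = uc x a * (tau (a - 1) k'.+1 x * tau (a + 2) k' x)) *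
    (denom k' (2 * a) x = tau (a + 1) k'.+1 x * tau a k' x) :> Type.
  rewrite /numer /denom (_ : (2 %| 2 * a)%Z = true); last by lia.
  by rewrite (_ : (2 * a %/ 2)%Z = a) //; lia.
clear p q fr pq p' q' fr' hp' hq' B tB.
case: k => [|[|k]] in hk main *; first by lia.
  (* The first iterate: the denominator 1 - u_s v_s of u_(s-1). *)
  have pf1 : polyfun (fun z : 'I_(2 * n) -> R => uc (ext z) (s - 1)).
    exact: polyfun_var.
  have pf2 : polyfun (fun z : 'I_(2 * n) -> R => tau (s - 2) 2 (ext z)).
    by apply: (polyfun_ext n_gt0); apply: polyfun_tau.
  have nf1 : nonzero_on_ext n_gt0 S (fun z : 'I_(2 * n) -> R => uc (ext z) (s - 1)).
    by apply: nzp_ones; rewrite /uc /ext oner_neq0.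
  have nf2 := N (s - 2) 1%N.
  have [|z sz [fz [P [Q [P0 Q0 E]]]]] := main (s - 1) _ (polyfunM pf1 pf2).
    by apply: nzp_irreducible => //; apply: nf2; lia.
  move: E; rewrite !NE subrK (@tau_first_row _ m s 1) //; last exact: sp.
  rewrite mul0r mulr0 => /esym/eqP; apply/negP.
  move: fz; rewrite mulf_eq0 negb_or => /andP[f1 f2].
  rewrite (_ : s - 1 - 1 = s - 2); last by lia.
  by rewrite !mulf_neq0 // tau1 oner_neq0.
(* The other iterates: the entry of row s in the numerator of u_(s-2). *)
have pf1 : polyfun (fun z : 'I_(2 * n) -> R => tau (s - 1) k.+3 (ext z)).
  by apply: (polyfun_ext n_gt0); apply: polyfun_tau.
have pf2 : polyfun (fun z : 'I_(2 * n) -> R => tau (s - 2) k.+2 (ext z)).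
  by apply: (polyfun_ext n_gt0); apply: polyfun_tau.
have [|z sz [fz [P [Q [P0 Q0 E]]]]] := main (s - 2) _ (polyfunM pf1 pf2).
  by apply: nzp_irreducible => //; apply: N; lia.
move: E; rewrite !NE subrK (@tau_first_row _ m s k.+1) //; [|lia|exact: sp].
rewrite !mulr0 mul0r => /eqP; apply/negP.
move: fz; rewrite mulf_eq0 negb_or => /andP[f1 f2].
rewrite (_ : s - 2 + 1 = s - 1); last by lia.
by rewrite !mulf_neq0.
Qed.

(** The layers 2, ..., m + 1 have zeros on the locus, but only the layers m + 2
    and m + 3 enter the fractions of the iterate m + 2. The index runs through
    the period of [nz_tau_layers]. *)
Definition last_product (z : 'I_(2 * n) -> R) := \prod_(c <- iota 0 n)
  (tau (s + 2 * m%:Z - 1 - n%:Z + c%:Z) m.+2 (ext z) *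
   tau (s + 2 * m%:Z - 1 - n%:Z + c%:Z) m.+3 (ext z)).

Lemma polyfun_last_product : polyfun last_product.
Proof.
by apply: polyfun_prod => c; apply: polyfunM; apply: (polyfun_ext n_gt0);
  apply: polyfun_tau.
Qed.

Lemma nzp_last_product : nonzero_on_ext n_gt0 S last_product.
Proof.
apply: nzp_prod => // [c|c].
  by apply: polyfunM; apply: (polyfun_ext n_gt0); apply: polyfun_tau.
rewrite mem_iota => hc.
apply: nzp_irreducible => //; try (apply: (polyfun_ext n_gt0); apply: polyfun_tau).
  by apply: nzp_tau => //; [lia|apply: nz_tau_layers; lia].
by apply: nzp_tau => //; [lia|apply: nz_tau_layers; lia].
Qed.

Lemma last_productP z l c : (m.+2 <= l <= m.+3)%N -> last_product z != 0 ->
  tau c l (ext z) != 0.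
Proof.
move=> hl; rewrite /last_product prodf_seq_neq0 => /allP h.
pose lo := s + 2 * m%:Z - 1 - n%:Z.
have n0 : n%:Z != 0 by lia.
have := divz_eq (c - lo) n%:Z; have := modz_ge0 (c - lo) n0; have := ltz_mod (c - lo) n0.
set t := (_ %/ _)%Z; set r := (_ %% _)%Z => h1 h2 h3.
have := h (absz r); rewrite mem_iota -/lo (_ : (absz r)%:Z = r); last by lia.
have -> : c = lo + r + t * n%:Z by lia.
rewrite tau_ext_period => /(_ _)/= H.
have : (0 <= `|r|%N < 0 + n)%N by lia.
move/H; rewrite mulf_eq0 negb_or => /andP[t2 t3].
by have [->|->] : l = m.+2 \/ l = m.+3 by lia.
Qed.

Lemma denom_last z J : last_product z != 0 -> denom (m + 2) J (ext z) != 0.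
Proof.
move=> hz; rewrite addn2 /denom.
by case: ifP => _; rewrite mulf_neq0 // last_productP //; lia.
Qed.

Lemma regular_iterate A : twisted false n A -> last_product (@xvec R false n A) != 0 ->
  regular_at false n (m + 2) A.
Proof.
move=> tA hA; pose k := (m + 2)%N; pose z := @xvec R false n A.
have [p [q [fr hp hq]]] := @iterate_fractions_exists R n n_gt0 k.
have x0 J : xcoord false A J != 0 by apply: (xcoord_neq0 J tA).
have e0 J : ext z J != 0 by rewrite /z -coords_ext // x0.
pose w (j : 'I_(2 * n)) :=
  numer k (j.+1%:Z - k%:Z) (ext z) / denom k (j.+1%:Z - k%:Z) (ext z).
have w0 j : w j != 0.
  rewrite mulf_neq0 // ?invr_eq0 ?denom_last // /numer /k addn2.
  by case: ifP => _; rewrite !mulf_neq0 ?last_productP //; try lia; apply: e0.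
have [B [tB xB]] := polygon_of_ext n_gt0 (odd k (+) false) w0.
exists B; split=> //; exists p, q; split=> // j.
by rewrite /ratfun_at hq hp xB; split=> //; apply: denom_last.
Qed.

(** The equation of Y_S' at this index is the recurrence around an entry of the
    layer m + 1 which vanishes on the locus. *)
Lemma value_coords A B t : (t < m)%N -> twisted false n A ->
  sing S (ext (@xvec R false n A)) -> last_product (@xvec R false n A) != 0 ->
  iterate_value false n (m + 2) A B ->
  let J := 2 * s + (m%:Z - 1) + 2 * t%:Z in
  xcoord (odd m) B J * xcoord (odd m) B (J + 1) = 1.
Proof.
move=> ht tA sA hA [_ tB [p [q [fr pq]]]] J.
set z := @xvec R false n A in sA hA pq *.
have [p' [q' [fr' hp' hq']]] := @iterate_fractions_exists R n n_gt0 (m + 2).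
have {}tB : twisted (odd m) n B by move: tB; rewrite oddD addbF addbF.
have xB K : xcoord (odd m) B K = numer (m + 2) (K - (m + 2)%:Z) (ext z) /
    denom (m + 2) (K - (m + 2)%:Z) (ext z).
  have := congr1 (fun f => f K) (coords_ext n_gt0 tB); rewrite /coords addr0 => ->.
  rewrite /ext; set j := idx n_gt0 K; have [q0 h] := pq j.
  have := iterate_fractions_unique n_gt0 fr fr' j z; rewrite hp' hq'.
  have -> : @xvec R (odd m) n B j = (p j).@[z] / (q j).@[z].
    by rewrite -h oddD !addbF.
  have [r hr] := idxE n_gt0 K.
  have -> : j.+1%:Z - (m + 2)%:Z = K - (m + 2)%:Z + - r * (2 * n)%:Z.
    by rewrite mulNr /j; lia.
  rewrite numer_period denom_period => E.
  by apply/eqP; rewrite eqr_div ?denom_last // E mulrC.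
pose a := s + t%:Z - 2.
have e1 : J - (m + 2)%:Z = 2 * a + 1 by rewrite /J /a; lia.
have e2 : J + 1 - (m + 2)%:Z = 2 * (a + 1) by rewrite /J /a; lia.
rewrite !xB e1 e2 /numer /denom.
rewrite (_ : (2 %| 2 * a + 1)%Z = false); last by lia.
rewrite (_ : (2 %| 2 * (a + 1))%Z = true); last by lia.
rewrite (_ : ((2 * a + 1) %/ 2)%Z = a); last by lia.
rewrite (_ : ((2 * (a + 1)) %/ 2)%Z = a + 1); last by lia.
rewrite addn2.
have T c l : (m.+2 <= l <= m.+3)%N -> tau c l (ext z) != 0.
  by move=> hl; apply: last_productP.
have := tauR (a + 1) m.+1 (ext z).
have i1 : a + 1 + 1 = a + 2 by lia.
have i2 : a + 1 - 1 = a by lia.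
have i3 : a + 1 + m.+1%:Z = a + m.+2%:Z by lia.
have i4 : a + 1 + 2 = a + 3 by lia.
rewrite i1 i2 i3 i4 (@tau_last_layer _ m s (a + 2)).
- rewrite mulr0 => /esym/eqP; rewrite subr_eq0 => /eqP E.
  have [l2 l3] : (m.+2 <= m.+2 <= m.+3)%N /\ (m.+2 <= m.+3 <= m.+3)%N by lia.
  have T1 := T (a + 3) m.+2 l2; have T2 := T a m.+2 l2.
  have T3 := T a m.+3 l3; have T4 := T (a + 3) m.+3 l3.
  have T5 := T (a + 1) m.+2 l2; have T6 := T (a + 2) m.+2 l2.
  have T7 := T (a + 2) m.+3 l3.
  rewrite mulf_div; set P := (X in X / _); set Q := (X in _ / X).
  have Q0 : Q != 0 by rewrite !mulf_neq0.
  suff -> : P = Q by rewrite divff.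
  by rewrite /P /Q; ring: E.
- by rewrite /a; lia.
- by apply: sing_sub sA => b; apply: periodic_prog_prog; lia.
Qed.
End Locus.

(** * The variety X_S and the theorem *)

Section Variety.
Variables (R : realType) (n m : nat) (s : int).
Hypotheses (n_gt0 : (0 < n)%N) (m_gt0 : (0 < m)%N) (n_large : (3 * m + 4 <= n)%N).

Lemma yparam_sing (A : polygon R) a : twisted false n A ->
  yparam false A (2 * a) = -1 <->
  uc (ext n_gt0 (@xvec R false n A)) a * vc (ext n_gt0 (@xvec R false n A)) a = 1.
Proof.
move=> tA; rewrite -coords_ext // /uc /vc /coords !addr0 /yparam.
rewrite (_ : has_parity false (2 * a)); last by rewrite /has_parity; lia.
split=> [/oppr_inj/eqP|->]; last by rewrite invr1.
by rewrite invr_eq1 => /eqP.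
Qed.

Lemma XvarE (i : int) (A : polygon R) : i - (m%:Z - 1) = s ->
  Xvar false n (progression (2 * i - 2 * (m%:Z - 1)) (2 * i + 2 * (m%:Z - 1)) 4) A <->
  twisted false n A /\ sing (periodic_prog n s m) (ext n_gt0 (@xvec R false n A)).
Proof.
move=> hs; split=> -[tA h]; split=> //.
  move=> a; pose b := s + ((a - s) %% n%:Z)%Z; rewrite /periodic_prog -/b => hb.
  pose q := ((a - s) %/ n%:Z)%Z.
  have ab : a = b + q * n%:Z by have := divz_eq (a - s) n%:Z; rewrite /b /q; lia.
  have U : uc (ext n_gt0 (@xvec R false n A)) a = uc (ext n_gt0 (@xvec R false n A)) b.
    by rewrite /uc -(ext_period _ _ (2 * b) q) ab; congr (ext _ _ _); lia.
  have V : vc (ext n_gt0 (@xvec R false n A)) a = vc (ext n_gt0 (@xvec R false n A)) b.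
    by rewrite /vc -(ext_period _ _ (2 * b + 1) q) ab; congr (ext _ _ _); lia.
  rewrite U V; apply/yparam_sing => //; apply: h; split.
    by move: hb; rewrite /prog; lia.
  by exists (absz (b - s)%R)./2; move: hb; rewrite /prog; lia.
move=> c [hb [t ht]]; have -> : c = 2 * (s + 2 * t%:Z) by lia.
by apply/yparam_sing => //; apply: h; apply: periodic_prog_prog; rewrite /prog; lia.
Qed.
End Variety.

Theorem theorem4p2 (R : realType) (n : nat) (i : int) (m : nat)
    (hn : (1 <= n)%N) (hm1 : (1 <= m)%N)
    (hm : (m%:R : rat) < n%:R / 3%:R - 1) :
  let S := progression (2 * i - 2 * (m%:Z - 1)) (2 * i + 2 * (m%:Z - 1)) 4 in
  let S' := progression (2 * i - (m%:Z - 1)) (2 * i + (m%:Z - 1)) 2 in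
  let XS := @Xvar R false n S in
  (forall k : nat, (1 <= k <= m + 1)%N ->
     forall A : polygon R, XS A -> singular_at false n k A) /\
  generically false n XS (fun A : polygon R =>
    regular_at false n (m + 2) A /\
    forall B : polygon R, iterate_value false n (m + 2) A B ->
      Yvar (odd (m - 1)) n S' B).
Proof.
have n_large : (3 * m + 4 <= n)%N.
  have : ((3 * m + 3)%:R < n%:R :> rat) by rewrite natrD natrM; lra.
  by rewrite ltr_nat; lia.
move=> S S' XS; pose s := i - (m%:Z - 1).
have XE A := @XvarE R n m s hn hm1 n_large i A erefl.
split=> [k hk A /XE[tA sA]|].
  by split=> //; apply: (singular_iterate hm1 n_large hk tA sA).
have perS : periodic n (periodic_prog n s m).
  by move=> a t; apply: periodic_prog_period; lia.
apply: (generically_intro (n_gt0 := hn) perS XE (f := @last_product R n m s hn)).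
- exact: polyfun_last_product.
- exact: nzp_last_product.
move=> A /XE[tA sA] hA; split; first exact: regular_iterate hA.
move=> B hB; have [_ tB _] := hB.
have om : odd m = ~~ odd (m - 1) by lia.
split; first by move: tB; rewrite oddD addbF addbF om.
move=> c [hb [t hc]]; rewrite hc /yparam.
rewrite (_ : has_parity _ _ = false); last by rewrite /has_parity; lia.
have ht : (t < m)%N by lia.
have := value_coords hm1 n_large ht tA sA hA hB; rewrite -om.
have -> : 2 * s + (m%:Z - 1) + 2 * t%:Z = 2 * i - (m%:Z - 1) + 2 * t%:Z by lia.
by move=> ->.
Qed.
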